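(* Let $k\ge1$, $c\ge0$, $n>k$ be integers, $s>0$, $\alpha>1$, $\Delta\ge0$, and let task execution times be i.i.d. $\mathrm{Pareto}(s,\alpha)$. Consider launching a job of $k$ tasks together with redundant tasks at time $0$ and then relaunching all remaining tasks (initial and redundant) at time $\Delta$ (models in the context). (Replication) When the job is launched with $c$ replicas for each task, let $q=\mathbf 1(\Delta>s)\bigl(1-(s/\Delta)^{(c+1)\alpha}\bigr)$ and $$\mathbb E[T_{norel}]=s\,k!\,\frac{\Gamma\bigl(1-\frac1{(c+1)\alpha}\bigr)}{\Gamma\bigl(k+1-\frac1{(c+1)\alpha}\bigr)}$$ (the expected job execution time without relaunch). Then $$\mathbb E[T]=\begin{cases}\Delta+\mathbb E[T_{norel}] & \Delta\le s,\\ \Delta(1-q^k)+\mathbb E[T_{norel}]\Bigl(1+\bigl(\tfrac s\Delta-1\bigr)I\bigl(1-q;\,1-\tfrac1{(c+1)\alpha},\,k\bigr)\Bigr) & \Delta>s.\end{cases}$$ (Coding) When the job is launched with $n-k$ coded tasks, let $q=\mathbf 1(\Delta>s)\bigl(1-(s/\Delta)^{\alpha}\bigr)$ and $$\mathbb E[T_{norel}]=s\,\frac{n!}{(n-k)!}\,\frac{\Gamma(n-k+1-1/\alpha)}{\Gamma(n+1-1/\alpha)}$$ (the expected job execution time without relaunch). Then $$\mathbb E[T]=\begin{cases}\Delta+\mathbb E[T_{norel}] & \Delta\le s,\\ \Delta\,I(1-q;\,n-k+1,\,k)+\mathbb E[T_{norel}]\Bigl(1+\bigl(\tfrac s\Delta-1\bigr)I(1-q;\,n-k+1-1/\alpha,\,k)\Bigr)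 & \Delta>s.\end{cases}$$
   Context: $\mathrm{Pareto}(s,\alpha)$: $\Pr\{X>x\}=(s/x)^\alpha$ for $x\ge s$, and $1$ for $x<s$. $\mathbf 1(\cdot)$ is the indicator. $I(x;m,n)=B(x;m,n)/B(m,n)$ is the regularized incomplete Beta function, with $B(x;m,n)=\int_0^xu^{m-1}(1-u)^{n-1}\,du$ and $B(m,n)=B(1;m,n)$. Replication with relaunch: each task is launched at time $0$ in $c+1$ copies with i.i.d. execution times; a task completes when its fastest copy does. Let $W_i$ be the minimum of the $c+1$ execution times of task $i$. If $W_i\le\Delta$, task $i$ completes at $Y_i=W_i$. If $W_i>\Delta$, all $c+1$ copies of task $i$ are cancelled at time $\Delta$ and replaced at once by $c+1$ fresh i.i.d. copies, and $Y_i=\Delta+W_i'$ with $W_i'$ the minimum of the $c+1$ fresh execution times. $T=\max_{1\le i\le k}Y_i$. Coding with relaunch: $n$ tasks with i.i.d. execution times $X_1,\dots,X_n$ are launched at time $0$, and completion of any $k$ tasks completes the job. Let $R$ be the number of $i$ with $X_i\le\Delta$. If $R\ge k$, $T$ is the $k$-th smallest of $X_1,\dots,X_n$. If $R<k$, the $n-R$ remaining tasks are cancelled at time $\Delta$ and replaced at once by $n-R$ fresh copies with i.i.d. execution times of the same distribution (independent of the past), and $T=\Delta+{}$the $(k-R)$-th smallest of these $n-R$ fresh execution times. *)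

(* Defs.v *)
From HB Require Import structures.
From mathcomp Require Import all_boot all_order all_algebra.
From mathcomp Require Import all_classical all_reals all_analysis.

Set Implicit Arguments.
Unset Strict Implicit.
Unset Printing Implicit Defensive.

Import Order.TTheory GRing.Theory Num.Theory.
Import numFieldNormedType.Exports.

Local Open Scope classical_set_scope.
Local Open Scope ring_scope.

Section SpecialFunctions.
Context {R : realType}.
Local Notation mu := (@lebesgue_measure R).

(* Meaningful for 0 < t, where the integrand is integrable; [Rintegral] is
   total and returns a junk value otherwise. *)
Definition Gamma (t : R) : R :=
  \int[mu]_(x in `]0, +oo[) (x `^ (t - 1) * expR (- x)).

(* Meaningful for 0 < m, 0 < n and 0 <= x <= 1.  The library's [beta_fun] only
   takes natural parameters. *)
Definition inc_beta (x m n : R) : R :=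
  \int[mu]_(u in `[0, x]) (u `^ (m - 1) * (1 - u) `^ (n - 1)).

Definition reg_inc_beta (x m n : R) : R := inc_beta x m n / inc_beta 1 m n.

End SpecialFunctions.

Section RandomVariables.
Context {R : realType} {d : measure_display} {Omega : measurableType d}.
Variable P : probability Omega R.

Definition pareto_rv (s alpha : R) (X : {RV P >-> R}) : Prop :=
  forall x : R, ccdf X x = (if s <= x then (s / x) `^ alpha else 1)%:E.

Definition mutually_independent (I : finType) (X : I -> {RV P >-> R}) : Prop :=
  forall (J : {set I}) (A : I -> set R), (forall i, measurable (A i)) ->
    P (\bigcap_(i in [set` J]) (X i @^-1` A i)) =
    (\prod_(i in J) P (X i @^-1` A i))%E.

Definition iid_pareto (s alpha : R) (I : finType) (X : I -> {RV P >-> R}) :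
    Prop :=
  mutually_independent X /\ forall i, pareto_rv s alpha (X i).

(* The family, indexed by [I + I], of all initial and all fresh times. *)
Definition initial_and_fresh (I : Type) (X X' : I -> {RV P >-> R})
    (z : I + I) : {RV P >-> R} :=
  match z with inl i => X i | inr i => X' i end.

End RandomVariables.

Section CompletionTimes.
Context {R : realType}.

(* The m-th smallest entry of s, for 1 <= m <= size s (m counts from 1). *)
Definition kth_smallest (m : nat) (s : seq R) : R :=
  nth 0 (sort <=%R s) m.-1.

(* The defaults of the two iterated operators below are values of the family,
   so these are the exact minimum and maximum. *)
Definition fastest_copy (c : nat) (x : 'I_c.+1 -> R) : R :=
  \big[Num.min/x ord0]_(j < c.+1) x j.

Definition slowest_task (k : nat) (hk : (0 < k)%N) (y : 'I_k -> R) : R :=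
  \big[Num.max/y (Ordinal hk)]_(i < k) y i.

(* x (i, j) is the execution time of the j-th initial copy of task i, and
   x' (i, j) that of the fresh copy which replaces it if task i is relaunched;
   x' is ignored on the tasks that are not relaunched. *)
Definition replication_time (k c : nat) (hk : (0 < k)%N)
    (x : 'I_k * 'I_c.+1 -> R) : R :=
  slowest_task hk (fun i => fastest_copy (fun j => x (i, j))).

Definition replication_relaunch_time (k c : nat) (hk : (0 < k)%N) (Delta : R)
    (x x' : 'I_k * 'I_c.+1 -> R) : R :=
  slowest_task hk (fun i =>
    let W := fastest_copy (fun j => x (i, j)) in
    let W' := fastest_copy (fun j => x' (i, j)) in
    if W <= Delta then W else Delta + W').

Definition coding_time (n k : nat) (x : 'I_n -> R) : R :=
  kth_smallest k [seq x i | i : 'I_n].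

(* x' i is the execution time of the fresh copy which replaces task i if
   task i is unfinished at time Delta. *)
Definition coding_relaunch_time (n k : nat) (Delta : R) (x x' : 'I_n -> R) :
    R :=
  let r := #|[pred i | x i <= Delta]| in
  if (k <= r)%N then kth_smallest k [seq x i | i : 'I_n]
  else Delta + kth_smallest (k - r) [seq x' i | i in [pred i | Delta < x i]].

End CompletionTimes.

(* Main.v *)
(* Without relaunch T > t means that at least n - k + 1 of the n completion times
   exceed t (n = k for replication).  With relaunch the same holds almost surely
   for the times "X_i if X_i <= Delta, else Delta + X'_i" (with W_i, W'_i for
   replication), which are again i.i.d., with survival function
   p t = S t for t < Delta and S Delta * S (t - Delta) for t >= Delta.  Hence
   P(T > t) is a binomial tail at p t, that is, the integral over [0, p t] of the
   Beta(n - k + 1, k) density h.  Integrating over t and applying Tonelli gives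
   E[T] = int_0^1 h(u) g(u) du, where g(u) is the length of {t >= 0 | u < p t}:
   g(u) = s u^(-1/a) without relaunch, Delta + s u^(-1/a) when Delta <= s, and
   s u^(-1/a) + 1(u < 1 - q) (Delta + (s / Delta - 1) s u^(-1/a)) when s < Delta.
   These are incomplete Beta integrals. *)

Require Import Defs.
From HB Require Import structures.
From mathcomp Require Import all_boot all_order all_algebra.
From mathcomp Require Import all_classical all_reals all_analysis.
From mathcomp Require Import measurable_realfun ring.

Set Implicit Arguments.
Unset Strict Implicit.
Unset Printing Implicit Defensive.

Import Order.TTheory GRing.Theory Num.Theory.
Import numFieldNormedType.Exports.
Local Open Scope classical_set_scope.
Local Open Scope ring_scope.

(** Replication and coding are instances of one computation: [m + j + 1] tasks with [N] copies each,
    where coding takes [m = n - k], [j = k - 1], [N = 1] and replication takes [m = 0], [j = k - 1],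
    [N = c + 1]. The exponent is [a = N * alpha] throughout. Two points hide behind the words almost
    surely. A relaunched task is late at every [t < Delta] only if its fresh time is positive, which
    the Pareto law gives only up to a null set. Moreover, coding relaunches nothing once [k] tasks
    are finished by [Delta]; pretending that the late tasks are relaunched anyway is harmless, since
    the k-th smallest time is at most [Delta] under both rules. No integrability of [T] is assumed
    beforehand: the exchange of integrals takes place in the extended reals, and finiteness comes
    from Beta integrals whose first parameter [m + 1 - 1/a] is positive because [a > 1]. Their
    second parameter is the integer [k], so the complete ones are explicit quotients, and Gamma
    enters only through its functional equation and its positivity. *)

(** * Two integration tools: powers near zero, and Tonelli on a plane region *)

Lemma integral_powR_0x (R : realType) (t x : R) : 0 < t -> 0 < x ->
  (\int[@lebesgue_measure R]_(u in `]0%R, x]) (u `^ (t - 1))%:E = (x `^ t / t)%:E)%E.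
Proof.
move=> t0 x0.
(* For [t < 1] the integrand is unbounded at 0, so the fundamental theorem is applied on compact
   intervals exhausting the half-open one, followed by monotone convergence. The [.+2] keeps every
   left end strictly below [x]. *)
have bigE : `]0, x]%classic = \bigcup_(i : nat) `[x / i.+2%:R, x]%classic :> set R.
  apply/seteqP; split=> [u /=|u [i _] /=]; rewrite !in_itv/=.
    move=> /andP[u0 ux]; exists (Num.truncn (x / u)) => //=; rewrite in_itv/= ux andbT.
    rewrite ler_pdivrMr// mulrC -ler_pdivrMr//.
    have /ltW xu := truncnS_gt (x / u).
    by rewrite (le_trans xu)// ler_nat.
  move=> /andP[xu ->]; rewrite andbT; apply: lt_le_trans xu.
  by rewrite divr_gt0.
rewrite bigE.
have : (\int[lebesgue_measure]_(u in `[(x / i.+2%:R)%R, x])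
    (u `^ (t - 1))%:E)%E @[i --> \oo] -->
    (\int[@lebesgue_measure R]_(u in \bigcup_(i : nat) `[(x / i.+2%:R)%R, x]%classic)
      (u `^ (t - 1))%:E)%E.
  apply: (@ge0_nondecreasing_set_cvg_integral _ (measurableTypeR R) R
    (fun i : nat => `[x / i.+2%:R, x]%classic)
    (fun u => (u `^ (t - 1))%:E)) => //.
  - move=> i j ij; apply/subsetPset => u /=; rewrite !in_itv/= => /andP[xu ->].
    rewrite andbT (le_trans _ xu)// ler_pM2l// lef_pV2 ?posrE//.
    by rewrite ler_nat !ltnS.
  - move=> i; apply/measurable_EFinP.
    by apply: measurable_funTS; exact: measurable_powR.
  - by move=> i u _; rewrite lee_fin powR_ge0.
have FTC i : (\int[lebesgue_measure]_(u in `[(x / i.+2%:R)%R, x]) (u `^ (t - 1))%:E =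
    (x `^ t / t - (x / i.+2%:R) `^ t / t)%:E)%E.
  have xi0 : 0 < x / i.+2%:R by rewrite divr_gt0.
  have pos (u : R) : x / i.+2%:R <= u -> 0 < u by apply: lt_le_trans.
  have dF (b u : R) : 0 < u -> is_derive u 1 (fun v => v `^ b) (b * u `^ (b - 1)).
    exact: is_derive1_powR.
  have cts (b u : R) : 0 < u -> {for u, continuous (fun v : R => v `^ b)}.
    move=> u0; apply/differentiable_continuous/derivable1_diffP.
    by have [] := dF b u u0.
  have dG (u : R) : 0 < u -> is_derive u 1 (fun v => v `^ t / t) (u `^ (t - 1)).
    move=> u0; have := dF t u u0 => ?.
    have -> : (fun v => v `^ t / t) = (fun v => t^-1 *: (v `^ t)).
      by apply/funext => v /=; rewrite mulrC.
    apply: is_derive_eq.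
    by rewrite /GRing.scale/= mulrA mulVf ?gt_eqF// mul1r.
  have cG (u : R) : 0 < u -> {for u, continuous (fun v : R => v `^ t / t)}.
    move=> u0; apply/differentiable_continuous/derivable1_diffP.
    by have [] := dG u u0.
  rewrite (@continuous_FTC2 _ _ (fun v => v `^ t / t)) ?EFinB//.
  - by rewrite ltr_pdivrMr// ltr_pMr// ltr1n.
  - apply: continuous_in_subspaceT => u; rewrite inE/= in_itv/= => /andP[/pos u0 _].
    exact: cts.
  - split.
    + move=> u; rewrite in_itv/= => /andP[/ltW/pos u0 _].
      by have [] := dG u u0.
    + by apply: cvg_at_right_filter; exact: cG.
    + by apply: cvg_at_left_filter; exact: cG.
  - move=> u; rewrite in_itv/= => /andP[/ltW/pos u0 _].
    by rewrite derive1E; have [] := dG u u0.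
rewrite (eq_cvg _ _ FTC) => /cvg_unique; apply => //.
apply/cvg_EFin; first exact: nearW.
rewrite -[X in _ --> X]subr0 -[X in _ - X](mul0r t^-1).
apply: cvgB; first exact: cvg_cst.
apply: cvgMl.
move/cvg_at_rightP : (powR_cvg0 t0) => /(_ (fun i => x / i.+2%:R)); apply.
split; first by move=> i; rewrite divr_gt0.
rewrite -[X in _ --> X](mulr0 x); apply: cvgMr.
have := @cvg_harmonic R.
rewrite -(cvg_shiftS (@harmonic R)).
exact.
Qed.

(** Both sides integrate [f x * g y * \1_Q (x, y)]. It serves twice: for the functional equation of
    Gamma, and to exchange the time with the Beta variable. *)
Lemma tonelli_section (R : realType)
    (Q : set (measurableTypeR R * measurableTypeR R)) (f g : R -> R) :
    measurable Q -> measurable_fun setT f -> measurable_fun setT g ->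
    (forall x, 0 <= f x) -> (forall x, 0 <= g x) ->
  (\int[@lebesgue_measure R]_x ((f x)%:E *
     \int[@lebesgue_measure R]_(y in xsection Q x) (g y)%:E) =
   \int[@lebesgue_measure R]_y ((g y)%:E *
     \int[@lebesgue_measure R]_(x in ysection Q y) (f x)%:E))%E.
Proof.
move=> mQ mf mg f0 g0.
pose F := fun z : measurableTypeR R * measurableTypeR R => (f z.1 * g z.2 * \1_Q z)%:E.
have FE x y : F (x, y) = (f x * g y * \1_Q (x, y))%:E by [].
have mF : measurable_fun setT F.
  apply/measurable_EFinP; apply: measurable_funM; last exact: measurable_indic.
  by apply: measurable_funM; exact: measurableT_comp.
have F0 z : (0 <= F z)%E by rewrite lee_fin mulr_ge0// mulr_ge0.
transitivity (\int[@lebesgue_measure R]_x \int[@lebesgue_measure R]_y F (x, y))%E.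
  apply: eq_integral => x _.
  rewrite [in LHS]integral_mkcond -ge0_integralZl//=.
  - apply: eq_integral => y _; rewrite /F/= patchE indicE mem_xsection.
    by case: (_ \in Q) => /=; rewrite ?mulr1 ?mulr0 ?mule0 ?EFinM.
  - apply/(measurable_restrictT _ _).1; first exact: measurable_xsection.
    by apply/measurable_EFinP; exact: measurable_funTS.
  - by move=> y _; apply: erestrict_ge0 => z _; rewrite lee_fin.
  - by rewrite lee_fin.
rewrite (fubini_tonelli F)//.
apply: eq_integral => y _.
rewrite [in RHS]integral_mkcond -ge0_integralZl//=.
- apply: eq_integral => x _; rewrite /F/= patchE indicE mem_ysection.
  by case: (_ \in Q) => /=; rewrite ?mulr1 ?mulr0 ?mule0 ?[f x * g y]mulrC ?EFinM.
- apply/(measurable_restrictT _ _).1; first exact: measurable_ysection.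
  by apply/measurable_EFinP; exact: measurable_funTS.
- by move=> x _; apply: erestrict_ge0 => z _; rewrite lee_fin.
- by rewrite lee_fin.
Qed.

(** * The Gamma function: functional equation, finiteness, positivity *)

Lemma integral_expRN_itvcy (R : realType) (u : R) :
  (\int[@lebesgue_measure R]_(x in `[u, +oo[) (expR (- x))%:E = (expR (- u))%:E)%E.
Proof.
have dF (x : R) : is_derive x 1 (fun y : R => - expR (- y)) (expR (- x)).
  by apply: is_derive_eq; rewrite mulrN1 opprK.
have cE (x : R) : {for x, continuous (fun y : R => expR (- y))}.
  apply: (@continuous_comp _ _ _ (fun y : R => - y)); first exact: opp_continuous.
  exact: continuous_expR.
rewrite (@ge0_continuous_FTC2y _ _ (fun x => - expR (- x)) _ 0)//.
- by rewrite EFinN oppeK add0e.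
- apply: continuous_in_subspaceT => x _; exact: cE.
- rewrite -oppr0; apply: cvgN; exact: cvgr_expR.
- by apply: cvg_at_right_filter; apply: cvgN; exact: cE.
- by move=> x _; rewrite derive1E; have [] := dF x.
Qed.

(* [Gamma t] is [fine (eGamma t)]. *)
Definition eGamma (R : realType) (t : R) : \bar R :=
  (\int[@lebesgue_measure R]_(x in `]0%R, +oo[) (x `^ (t - 1) * expR (- x))%:E)%E.

Lemma measurable_Gamma_integrand (R : realType) (t : R) :
  measurable_fun setT (fun x : R => x `^ (t - 1) * expR (- x)).
Proof.
apply: measurable_funM; first exact: measurable_powR.
by apply: measurableT_comp => //; exact: measurableT_comp.
Qed.

(* Tonelli applied to [u `^ (t - 1) * expR (- x)] on [0 < u <= x]. *)
Lemma eGammaS (R : realType) (t : R) : 0 < t ->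
  eGamma (t + 1) = (t%:E * eGamma t)%E.
Proof.
move=> t0.
pose Q := [set z : measurableTypeR R * measurableTypeR R | 0 < z.1 <= z.2].
have mQ : measurable Q.
  have -> : Q = [set z | 0 < z.1] `&` [set z | z.1 <= z.2].
    by apply/seteqP; split=> z /= /andP.
  apply: measurableI.
  - have -> : [set z : measurableTypeR R * measurableTypeR R | 0 < z.1] =
      fst @^-1` `]0, +oo[%classic.
      by apply/seteqP; split=> z /=; rewrite in_itv/= andbT.
    rewrite -[X in measurable X]setTI; exact: (measurable_fst measurableT).
  - have : measurable_fun setT (fun z : measurableTypeR R * measurableTypeR R => z.1 <= z.2).
      exact: measurable_fun_ler.
    by move=> /(_ measurableT [set true] I); rewrite setTI.
have xQ (x : R) : xsection Q x = if 0 < x then `[x, +oo[%classic else set0.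
  apply/seteqP; split=> y; rewrite /xsection/= inE/=.
    by case/andP => -> /=; rewrite in_itv/= andbT.
  by rewrite /Q/=; case: ifPn => //= x0; rewrite in_itv/= andbT.
have yQ (y : R) : ysection Q y = `]0, y]%classic.
  by apply/seteqP; split=> x; rewrite /ysection/= inE/= in_itv.
have := tonelli_section mQ (@measurable_powR R (t - 1)) (f := fun x => x `^ (t - 1))
  (g := fun x => expR (- x)).
move=> /(_ _ (fun x => powR_ge0 _ _) (fun x => expR_ge0 _)) => tonelli.
(* Integrating exp(-y) over y >= x first gives the integrand of Gamma at [t]; integrating x^(t-1)
   over 0 < x <= y first gives y^t / t. *)
have {tonelli} : eGamma t =
    (\int[lebesgue_measure]_(x in `]0%R, +oo[) (t^-1%:E * (x `^ (t + 1 - 1) * expR (- x))%:E))%E.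
  rewrite /eGamma integral_mkcond [RHS]integral_mkcond.
  transitivity (\int[@lebesgue_measure R]_x ((x `^ (t - 1))%:E *
     \int[@lebesgue_measure R]_(y in xsection Q x) (expR (- y))%:E))%E.
    apply: eq_integral => x _; rewrite patchE xQ mem_setE in_itv/= andbT.
    by case: ifPn => _; rewrite ?integral_set0 ?mule0// integral_expRN_itvcy.
  rewrite tonelli; last by apply: measurableT_comp => //; exact: measurableT_comp.
  apply: eq_integral => x _; rewrite patchE yQ mem_setE in_itv/= andbT addrK.
  case: ifPn => x0; first by rewrite integral_powR_0x// -!EFinM; congr EFin; ring.
  by rewrite set_itv_ge ?integral_set0 ?mule0// bnd_simp -leNgt leNgt.
move=> ->; rewrite ge0_integralZl//.
- by rewrite muleA -EFinM divff ?gt_eqF// mul1e.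
- apply/measurable_EFinP; apply: measurable_funTS; exact: measurable_Gamma_integrand.
- by move=> x _; rewrite lee_fin mulr_ge0 ?powR_ge0 ?expR_ge0.
- by rewrite lee_fin invr_ge0 ltW.
Qed.

Lemma eGamma_ge0 (R : realType) (t : R) : (0 <= eGamma t)%E.
Proof.
by apply: integral_ge0 => x _; rewrite lee_fin mulr_ge0 ?powR_ge0 ?expR_ge0.
Qed.

(** For [t <= 1], x^(t-1) dominates on ]0, 1] and exp(-x) dominates on ]1, +oo[. Larger [t] come
    down to this case by the functional equation, which holds in the extended reals and so needs no
    prior finiteness. *)
Lemma eGamma_lty (R : realType) (t : R) : 0 < t -> (eGamma t < +oo)%E.
Proof.
have base (y : R) : 0 < y <= 1 -> (eGamma y < +oo)%E.
  move=> /andP[y0 y1].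
  have mG (D : set (measurableTypeR R)) :
      measurable_fun D (fun x : R => (x `^ (y - 1) * expR (- x))%:E).
    by apply/measurable_EFinP/measurable_funTS; exact: measurable_Gamma_integrand.
  have itvU : `]0%R, +oo[%classic = `]0%R, 1%R] `|` `]1%R, +oo[ :> set (measurableTypeR R).
    apply/seteqP; split=> x /=; rewrite !in_itv/= !andbT.
      by move=> x0; have [x1|x1] := leP x 1; [left; rewrite x0|right].
    by move=> [/andP[]|/(lt_trans _)]//; apply.
  rewrite /eGamma itvU.
  rewrite ge0_integral_setU//=; last 2 first.
    by move=> x _; rewrite lee_fin mulr_ge0 ?powR_ge0 ?expR_ge0.
    apply/disj_setPS => x [] /=; rewrite !in_itv/= andbT => /andP[_ x1] x1'.
    by rewrite leNgt x1' in x1.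
  apply: lte_add_pinfty.
    apply: (@le_lt_trans _ _ (\int[lebesgue_measure]_(u in `]0%R, 1%R]) (u `^ (y - 1))%:E)%E).
      apply: ge0_le_integral => //.
      - by move=> x _; rewrite lee_fin mulr_ge0 ?powR_ge0 ?expR_ge0.
      - by apply/measurable_EFinP/measurable_funTS; exact: measurable_powR.
      - move=> x /=; rewrite in_itv/= => /andP[x0 _].
        rewrite lee_fin ler_piMr ?powR_ge0// -expR0 ler_expR oppr_le0.
        exact: ltW.
    by rewrite integral_powR_0x// ltry.
  apply: (@le_lt_trans _ _ (\int[lebesgue_measure]_(u in `]1%R, +oo[) (expR (- u))%:E)%E).
    apply: ge0_le_integral => //.
    - by move=> x _; rewrite lee_fin mulr_ge0 ?powR_ge0 ?expR_ge0.
    - apply/measurable_EFinP/measurable_funTS.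
      by apply: measurableT_comp => //; exact: measurableT_comp.
    - move=> x /=; rewrite in_itv/= andbT => x1.
      rewrite lee_fin ler_piMl ?expR_ge0// -[leRHS](powRr0 x).
      by apply: ler_powR; [exact: ltW|rewrite subr_le0].
  rewrite integral_itv_obnd_cbnd ?integral_expRN_itvcy ?ltry//.
  apply/measurable_EFinP/measurable_funTS.
  by apply: measurableT_comp => //; exact: measurableT_comp.
have bounded n : forall y : R, 0 < y <= n.+1%:R -> (eGamma y < +oo)%E.
  elim: n => [//|n IHn] y /andP[y0 yn].
  have [y1|y1] := leP y 1; first by apply: base; rewrite y0.
  rewrite -(subrK 1 y) eGammaS ?subr_gt0// lte_mul_pinfty ?lee_fin ?subr_ge0 ?ltW//.
  by apply: IHn; rewrite subr_gt0 y1 lerBlDr natr1.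
move=> t0; apply: (bounded (Num.truncn t)).
by rewrite t0 ltW// truncnS_gt.
Qed.

Lemma eGamma_fin_num (R : realType) (t : R) : 0 < t -> eGamma t \is a fin_num.
Proof. by move=> t0; rewrite ge0_fin_numE ?eGamma_ge0// eGamma_lty. Qed.

Lemma Gamma_gt0 (R : realType) (t : R) : 0 < t -> 0 < Gamma t.
Proof.
move=> t0; rewrite -lte_fin fineK ?eGamma_fin_num//.
(* On [1, 2] the integrand is at least exp(-2) / 2, because t - 1 >= -1 gives x^(t-1) >= 1/x >=
   1/2. *)
apply: (@lt_le_trans _ _ (\int[@lebesgue_measure R]_(u in `[1%R, 2%R])
    (cst (expR (- 2) / 2)%:E u))%E).
  rewrite integral_cst//=; rewrite lebesgue_measure_itv/= lte_fin ltr1n -EFinB -EFinM lte_fin.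
  by rewrite mulr_gt0 ?divr_gt0 ?expR_gt0// subr_gt0 ltr1n.
have mG (D : set (measurableTypeR R)) :
    measurable_fun D (fun x : R => (x `^ (t - 1) * expR (- x))%:E).
  by apply/measurable_EFinP/measurable_funTS; exact: measurable_Gamma_integrand.
apply: (@le_trans _ _ (\int[@lebesgue_measure R]_(x in `[1%R, 2%R])
    (x `^ (t - 1) * expR (- x))%:E)%E).
  apply: ge0_le_integral => //.
  - by move=> x _; rewrite lee_fin mulr_ge0 ?powR_ge0 ?expR_ge0.
  - move=> x /=; rewrite in_itv/= => /andP[x1 x2].
    rewrite lee_fin mulrC ler_pM ?expR_ge0// ?invr_ge0//.
      apply: (@le_trans _ _ (x `^ (-1))).
        by rewrite powR_inv1 ?(le_trans _ x1)// lef_pV2 ?posrE ?(lt_le_trans _ x1).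
      by rewrite ler_powR// lerDr ltW.
    by rewrite ler_expR lerN2.
apply: ge0_subset_integral => //.
  by move=> x _; rewrite lee_fin mulr_ge0 ?powR_ge0 ?expR_ge0.
by move=> x /=; rewrite !in_itv/= andbT => /andP[x1 _]; exact: lt_le_trans x1.
Qed.

Lemma GammaS (R : realType) (t : R) : 0 < t -> Gamma (t + 1) = t * Gamma t.
Proof.
move=> t0; have := eGammaS t0; rewrite -(fineK (eGamma_fin_num t0)) -EFinM.
by move=> /(congr1 fine).
Qed.

Lemma GammaD_nat (R : realType) (t : R) (j : nat) : 0 < t ->
  Gamma (t + j%:R) = (\prod_(i < j) (t + i%:R)) * Gamma t.
Proof.
move=> t0; elim: j => [|j IHj]; first by rewrite addr0 big_ord0 mul1r.
have tj0 : 0 < t + j%:R by rewrite ltr_wpDr.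
rewrite -natr1 addrA (GammaS tj0) IHj big_ord_recr/= mulrA.
by rewrite [X in X * _ = _]mulrC.
Qed.

(** * Beta integrals with an integer second parameter *)

Definition beta_integrand (R : realType) (y : R) (j : nat) (u : R) : R :=
  u `^ (y - 1) * (1 - u) ^+ j.

Lemma measurable_beta_integrand (R : realType) (y : R) j :
  measurable_fun setT (beta_integrand y j).
Proof.
apply: measurable_funM; first exact: measurable_powR.
by apply: measurable_funX; exact: measurable_funB.
Qed.

Lemma integrable_beta (R : realType) (y : R) j (r : R) : 0 < y -> 0 <= r <= 1 ->
  (@lebesgue_measure R).-integrable `[0, r] (EFin \o beta_integrand y j).
Proof.
move=> y0 /andP[r0 r1].
apply: (@integrableS _ (measurableTypeR R) _ _ `[0, 1]%classic) => //.
  by move=> x /=; rewrite !in_itv/= => /andP[-> /= /le_trans]; apply.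
apply: (@le_integrable _ (measurableTypeR R) _ _ _ _ _ (fun u => (u `^ (y - 1))%:E)) => //.
- by apply/measurable_EFinP/measurable_funTS; exact: measurable_beta_integrand.
- move=> x /=; rewrite in_itv/= => /andP[x0 x1].
  rewrite lee_fin /beta_integrand normrM ler_piMr// ger0_norm ?exprn_ge0 ?subr_ge0//.
  by rewrite exprn_ile1 ?subr_ge0// gerBl.
- have mp (D : set (measurableTypeR R)) : measurable_fun D (fun u : R => (u `^ (y - 1))%:E).
    by apply/measurable_EFinP/measurable_funTS; exact: measurable_powR.
  apply/integrableP; split => //.
  under eq_integral do rewrite gee0_abs ?lee_fin ?powR_ge0//.
  rewrite -integral_itv_obnd_cbnd; last exact: mp.
  by rewrite integral_powR_0x// ltry.
Qed.

Lemma inc_betaE (R : realType) (y r : R) j : r <= 1 ->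
  inc_beta r y j.+1%:R = \int[@lebesgue_measure R]_(u in `[0, r]) beta_integrand y j u.
Proof.
move=> r1; apply: eq_Rintegral => u; rewrite inE/= in_itv/= => /andP[u0 ur].
by rewrite -natr1 addrK powR_mulrn// subr_ge0 (le_trans ur).
Qed.

(** Splitting off one factor 1 - u gives B(y, j+2) = B(y, j+1) - B(y+1, j+1), so induction on [j]
    with [y] free suffices. *)
Lemma inc_beta1 (R : realType) (y : R) j : 0 < y ->
  inc_beta 1 y j.+1%:R = j`!%:R / \prod_(i < j.+1) (y + i%:R).
Proof.
have pos (z : R) m : 0 < z -> \prod_(i < m) (z + i%:R) != 0.
  by move=> z0; rewrite gt_eqF// prodr_gt0// => i _; rewrite ltr_wpDr.
elim: j y => [|j IHj] y y0; rewrite inc_betaE//.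
  rewrite /Rintegral -integral_itv_obnd_cbnd; last first.
    by apply/measurable_EFinP/measurable_funTS; exact: measurable_beta_integrand.
  under eq_integral do rewrite /beta_integrand expr0 mulr1.
  by rewrite integral_powR_0x//= powR1 big_ord1 addr0.
transitivity (\int[@lebesgue_measure R]_(u in `[0, 1])
    (beta_integrand y j u - beta_integrand (y + 1) j u)).
  apply: eq_Rintegral => u; rewrite inE/= in_itv/= => /andP[u0 u1].
  rewrite /beta_integrand exprS -[in RHS](@mulr_powRB1 _ u (y + 1 - 1)) ?addrK//.
  by ring.
have y1 : 0 < y + 1 by rewrite ltr_wpDr.
rewrite RintegralB//; [|by apply: integrable_beta; rewrite ?lexx ?ler01..].
rewrite -!inc_betaE// !IHj//.
set Q := \prod_(i < j) (y + 1 + i%:R).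
have shift m : \prod_(i < m.+1) (y + i%:R) = y * \prod_(i < m) (y + 1 + i%:R).
  rewrite big_ord_recl addr0; congr (_ * _); apply: eq_bigr => i _.
  by rewrite lift0 -[i.+1%:R]natr1; ring.
rewrite !shift big_ord_recr/= -/Q factS natrM.
have Q0 : Q != 0 by exact: pos.
have yj : y + 1 + j%:R != 0 by rewrite gt_eqF// ltr_wpDr.
rewrite -[j.+1%:R]natr1; field.
by rewrite Q0 yj gt_eqF.
Qed.

Lemma inc_beta1_Gamma (R : realType) (y : R) j : 0 < y ->
  inc_beta 1 y j.+1%:R = j`!%:R * (Gamma y / Gamma (y + j.+1%:R)).
Proof.
move=> y0; rewrite inc_beta1// GammaD_nat// invfM.
by rewrite [X in _ = _ * X]mulrCA divff ?mulr1// gt_eqF// Gamma_gt0.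
Qed.

(** * Binomial tails as polynomials *)

(** The probability of at least [m] successes in [n] trials, as a polynomial in the success
    probability, so that it can be differentiated formally. *)
Definition binomial_tail (R : realType) (n m : nat) : {poly R} :=
  \sum_(i < n.+1 | (m <= i)%N) ('X^i * (1 - 'X) ^+ (n - i)) *+ 'C(n, i).

Lemma binomial_tail_full (R : realType) (n : nat) : binomial_tail R n n = 'X^n.
Proof.
rewrite /binomial_tail (bigD1 ord_max)//= big1 ?addr0.
  by rewrite subnn expr0 mulr1 binn mulr1n.
move=> i /andP[ni]; rewrite -val_eqE/= eqn_leq ni andbT.
by rewrite -ltnS ltn_ord.
Qed.

Lemma binomial_tail_recl (R : realType) (n m : nat) : (m <= n)%N ->
  binomial_tail R n m =
  ('X^m * (1 - 'X) ^+ (n - m)) *+ 'C(n, m) + binomial_tail R n m.+1.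
Proof.
rewrite -ltnS => mn; rewrite /binomial_tail (bigD1 (Ordinal mn))//=; congr (_ + _).
by apply: eq_bigl => i; rewrite -val_eqE/= ltn_neqAle eq_sym andbC.
Qed.

(** The derivative telescopes: by the absorption identities for binomial coefficients, the negative
    part of the derivative of the term of index m + 1 cancels the derivative of the remaining tail,
    known by induction from the top index downwards. *)
Lemma deriv_binomial_tail (R : realType) (m j : nat) :
  (binomial_tail R (m + j).+1 m.+1)^`() =
  ('X^m * (1 - 'X) ^+ j) *+ ((m + j).+1 * 'C(m + j, m)).
Proof.
elim: j m => [|j IHj] m.
  by rewrite addn0 binomial_tail_full derivXn binn muln1 expr0 mulr1.
rewrite binomial_tail_recl ?ltnS ?leq_addr//= derivD addnS -addSn IHj addSn -addnS.
rewrite subSS [(_ - _)%N]addKn.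
rewrite derivMn derivM derivXn deriv_exp derivB derivX -polyC1 derivC sub0r.
rewrite /= mulN1r mulNrn mulrN mulrnAl mulrnAr mulrnDl mulNrn -!mulrnA.
rewrite -(mul_bin_diag (m + j.+1).+1 m).
have -> : (j.+1 * 'C((m + j.+1).+1, m.+1) = (m + j.+1).+1 * 'C(m + j.+1, m.+1))%N.
  by rewrite (mul_bin_down (m + j.+1).+1 m.+1) subSS addKn.
by rewrite subrK.
Qed.

Lemma horner_binomial_tail (R : realType) (n m : nat) (p : R) :
  (binomial_tail R n m).[p] =
  \sum_(i < n.+1 | (m <= i)%N) (p ^+ i * (1 - p) ^+ (n - i)) *+ 'C(n, i).
Proof.
rewrite horner_sum; apply: eq_bigr => i _.
by rewrite hornerMn hornerM !horner_exp hornerD hornerN hornerX hornerC.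
Qed.

(** * The number of occurring events among independent events of equal probability *)

Lemma probability_finType_partition (R : realType) (d : measure_display) (T : measurableType d)
    (P : probability T R) (I : finType) (X : T -> I) (Q : pred I) :
  (forall i, measurable [set w | X w == i]) ->
  P [set w | Q (X w)] = (\sum_(i | Q i) P [set w | X w == i])%E.
Proof.
move=> mX.
have -> : [set w | Q (X w)] = \bigcup_(i in [set` Q]) [set w | X w == i].
  apply/seteqP; split=> [w QXw|w [i Qi /= /eqP ->//]].
  by exists (X w) => //=.
rewrite measure_fin_bigcup//.
- rewrite -(@bigfs _ _ _ _ (index_enum I))//; first exact: index_enum_uniq.
  by move=> i _; rewrite mem_index_enum.
- by move=> i j _ _ [w [/= /eqP <- /eqP]].
Qed.

Section count.
Context (R : realType) (d : measure_display) (T : measurableType d) (P : probability T R).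
Context (n : nat) (p : R) (b : 'I_n -> T -> bool).
Hypothesis mb : forall i, measurable [set w | b i w].
Hypothesis Pb : forall J : {set 'I_n}, P [set w | [forall i in J, b i w]] = (p ^+ #|J|)%:E.

Let mI (c : 'I_n -> T -> bool) (J : {set 'I_n}) : (forall i, measurable [set w | c i w]) ->
  measurable [set w | [forall i in J, c i w]].
Proof.
move=> mc.
have -> : [set w | [forall i in J, c i w]] = \bigcap_(i in [set` J]) [set w | c i w].
  apply/seteqP; split=> [w /= /forall_inP h i /= /h//|w /= h].
  by apply/forall_inP => i iJ; exact: h.
by apply: fin_bigcap_measurable => //; exact: finite_finset.
Qed.

Let mbN i : measurable [set w | ~~ b i w].
Proof.
have -> : [set w | ~~ b i w] = ~` [set w | b i w].
  by apply/seteqP; split=> w /= /negP.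
exact: measurableC.
Qed.

Let mJK (J K : {set 'I_n}) :
  measurable [set w | [forall i in J, b i w] && [forall i in K, ~~ b i w]].
Proof.
have -> : [set w | [forall i in J, b i w] && [forall i in K, ~~ b i w]] =
    [set w | [forall i in J, b i w]] `&` [set w | [forall i in K, ~~ b i w]].
  by apply/seteqP; split=> w /= /andP.
by apply: measurableI; apply: mI.
Qed.

(** [Pb] gives only the probabilities of intersections. Induction on the size of [K]: dropping [k]
    from [K] leaves an event that splits into the wanted one and the one with [k] added to [J], so
    the wanted probability is a difference. *)
Lemma probability_pattern (J K : {set 'I_n}) : (forall i, i \in J -> i \notin K) ->
  P [set w | [forall i in J, b i w] && [forall i in K, ~~ b i w]] =
  (p ^+ #|J| * (1 - p) ^+ #|K|)%:E.
Proof.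
have [m] := ubnP #|K|; elim: m J K => // m IHm J K Km JK.
have [->|[k kK]] := set_0Vmem K.
  rewrite cards0 expr0 mulr1 -Pb; congr (P _); apply/seteqP; split=> w /=.
    by case/andP.
  by move=> ->; apply/forall_inP => i; rewrite inE.
have kJ : k \notin J by apply/negP => /JK; rewrite kK.
have KE : #|K| = #|K :\ k|.+1 by rewrite (cardsD1 k K) kK.
have dJ i : i \in J -> i \notin K :\ k by move=> /JK; rewrite !inE negb_and orbC => ->.
have dkJ i : i \in k |: J -> i \notin K :\ k.
  by rewrite in_setU1 => /predU1P[->|/dJ//]; rewrite !inE eqxx.
have := IHm (k |: J) (K :\ k) _ dkJ; rewrite -ltnS -KE => /(_ Km).
have := IHm J (K :\ k) _ dJ; rewrite -ltnS -KE => /(_ Km).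
pose A := [set w | [forall i in J, b i w] && [forall i in K, ~~ b i w]].
pose B := [set w | [forall i in k |: J, b i w] && [forall i in K :\ k, ~~ b i w]].
rewrite -/A -/B.
have -> : [set w | [forall i in J, b i w] && [forall i in K :\ k, ~~ b i w]] = A `|` B.
  apply/seteqP; split=> w /=.
    move=> /andP[/forall_inP hJ /forall_inP hK]; have [bk|bk] := boolP (b k w).
      right; apply/andP; split; apply/forall_inP => i; last exact: hK.
      by rewrite in_setU1 => /predU1P[->//|]; exact: hJ.
    left; apply/andP; split; apply/forall_inP => i; first exact: hJ.
    by have [->//|ik iK] := eqVneq i k; apply: hK; rewrite in_setD1 ik.
  case=> /andP[/forall_inP hJ /forall_inP hK]; apply/andP; split; apply/forall_inP => i iJK.
  - exact: hJ.
  - by apply: hK; move: iJK; rewrite in_setD1 => /andP[].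
  - by apply: hJ; rewrite in_setU1 iJK orbT.
  - exact: hK.
have -> : P (A `|` B) = (P A + P B)%E.
  apply: measureU; [exact: mJK..|].
  apply/seteqP; split=> // w /= -[/andP[_ /forall_inP /(_ _ kK) nk] /andP[/forall_inP /(_ k)]].
  by rewrite in_setU1 eqxx (negbTE nk) => /(_ isT).
move=> + Pk; rewrite Pk cardsU1 kJ KE add1n !exprS => /eqP.
have : P A \is a fin_num by apply: fin_num_measure; exact: mJK.
move: (P A) => x xfin; rewrite -(fineK xfin) -EFinD => /eqP[xE]; congr EFin.
by rewrite (canRL (addrK _) xE); ring.
Qed.

Lemma probability_count (m : nat) :
  P [set w | (m <= #|[pred i | b i w]|)%N] = ((binomial_tail R n m).[p])%:E.
Proof.
pose X w := [set i | b i w]%SET.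
(* The exact set of occurring indices partitions the space; a set of size [i] contributes p^i
   (1-p)^(n-i), and there are ['C(n, i)] of them. *)
have XE w (S : {set 'I_n}) : (X w == S) =
    [forall i in S, b i w] && [forall i in ~: S, ~~ b i w].
  apply/eqP/andP => [<-|[/forall_inP hS /forall_inP hNS]].
    by split; apply/forall_inP => i; rewrite !inE.
  apply/setP => i; rewrite inE; have [/hS//|/negP iS] := boolP (i \in S).
  by apply/negbTE/hNS; rewrite inE; apply/negP.
have XS (S : {set 'I_n}) : [set w | X w == S] =
    [set w | [forall i in S, b i w] && [forall i in ~: S, ~~ b i w]].
  by apply/seteqP; split=> w /=; rewrite XE.
transitivity (P [set w | (m <= #|X w|)%N]).
  by congr (P _); apply/seteqP; split=> w /=; rewrite cardsE.
rewrite (@probability_finType_partition _ _ _ _ _ X (fun S => (m <= #|S|)%N)); last first.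
  by move=> S; rewrite XS; exact: mJK.
under eq_bigr => S _.
  rewrite XS probability_pattern; last by move=> i iS; rewrite inE iS.
  rewrite [#|~: S|]cardsCs finset.setCK card_ord.
  over.
rewrite sumEFin; congr EFin; rewrite horner_binomial_tail.
have lt_card (S : {set 'I_n}) : (#|S| < n.+1)%N by rewrite ltnS -[leqRHS](card_ord n) max_card.
rewrite (partition_big (fun S : {set 'I_n} => Ordinal (lt_card S))
  (fun i : 'I_n.+1 => (m <= i)%N))//=.
apply: eq_bigr => i mi.
transitivity (\sum_(S in [set S : {set 'I_n} | #|S| == i]%SET) (p ^+ i * (1 - p) ^+ (n - i))).
  apply: eq_big => S; first by rewrite inE -val_eqE/=; case: eqP => [->|]; rewrite ?mi ?andbF.
  by move=> /andP[_ /eqP <-].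
by rewrite sumr_const card_draws card_ord.
Qed.
End count.

(** * Measurability from finitely many events and from upper rays *)

Lemma measurable_finite_events (d : measure_display) (T : measurableType d) (I : finType)
    (b : I -> T -> bool) (Q : pred {set I}) :
  (forall i, measurable [set w | b i w]) ->
  measurable [set w | Q [set i | b i w]%SET].
Proof.
move=> mb.
have -> : [set w | Q [set i | b i w]%SET] =
    \bigcup_(S in [set` Q]) \bigcap_(i in [set: I]) [set w | b i w = (i \in S)].
  apply/seteqP; split=> [w Qw|w [S QS bS] /=].
    by exists [set i | b i w]%SET => // i _ /=; rewrite inE.
  suff -> : [set i | b i w]%SET = S by [].
  by apply/setP => i; rewrite inE; exact: bS.
apply: fin_bigcup_measurable => // S _; apply: fin_bigcap_measurable => // i _.
case: (i \in S); first exact: mb.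
rewrite [X in measurable X](_ : _ = ~` [set w | b i w]); first exact: measurableC.
by apply/seteqP; split=> w /=; [move=> ->|move/negP/negbTE].
Qed.

Lemma measurable_count (d : measure_display) (T : measurableType d) (I : finType)
    (b : I -> T -> bool) (Q : pred nat) :
  (forall i, measurable [set w | b i w]) ->
  measurable [set w | Q #|[pred i | b i w]|].
Proof.
move=> mb.
rewrite [X in measurable X](_ : _ = [set w | Q #|[set i | b i w]%SET|]).
  exact: (@measurable_finite_events _ _ _ _ (fun S => Q #|S|)).
by apply/seteqP; split=> w /=; rewrite cardsE.
Qed.

Lemma measurable_fun_ray (R : realType) (d : measure_display) (T : measurableType d)
    (f : T -> R) :
  (forall t, measurable [set w | t < f w]) -> measurable_fun setT f.
Proof.
move=> mf; apply: (measurability _ (RGenOInfty.measurableE R)).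
move=> _ [_ [t ->] <-]; rewrite setTI.
rewrite [X in measurable X](_ : _ = [set w | t < f w])//.
by apply/seteqP; split=> w /=; rewrite in_itv/= andbT.
Qed.

Lemma measurable_fun_gt (R : realType) (d : measure_display) (T : measurableType d)
    (f : T -> R) (t : R) : measurable_fun setT f -> measurable [set w | t < f w].
Proof.
move=> mf; rewrite [X in measurable X](_ : _ = f @^-1` `]t, +oo[%classic).
  by rewrite -[X in measurable X]setTI; exact: mf.
by apply/seteqP; split=> w /=; rewrite in_itv/= andbT.
Qed.

(** * Binomial tails as incomplete Beta integrals *)

(** The integrand is the derivative of the tail polynomial, which vanishes at 0 since all its terms
    have index at least m + 1. *)
Lemma integral_binomial_tail (R : realType) (m j : nat) (p : R) : 0 <= p ->
  (\int[@lebesgue_measure R]_(u in `[0%R, p])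
     (((m + j).+1 * 'C(m + j, m))%:R * beta_integrand m.+1%:R j u)%:E =
   ((binomial_tail R (m + j).+1 m.+1).[p])%:E)%E.
Proof.
set K := (_ * _)%N; set H := binomial_tail _ _ _.
have H0 : H.[0] = 0.
  rewrite horner_binomial_tail big1// => i mi.
  by rewrite expr0n gtn_eqF ?mul0r ?mul0rn// (leq_trans _ mi).
rewrite le_eqVlt => /predU1P[<-|p0]; first by rewrite set_itv1 integral_set1 H0.
have dH u : H^`().[u] = K%:R * (u ^+ m * (1 - u) ^+ j).
  rewrite deriv_binomial_tail -/K hornerMn hornerM !horner_exp hornerD hornerN hornerX hornerC.
  by rewrite mulr_natl.
transitivity (\int[@lebesgue_measure R]_(u in `[0%R, p]) ((H^`()).[u])%:E)%E.
  apply: eq_integral => u; rewrite inE/= in_itv/= => /andP[u0 _].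
  by rewrite dH /beta_integrand -natr1 addrK powR_mulrn.
rewrite (@continuous_FTC2 _ _ (horner H))//.
- by rewrite H0 oppe0 adde0.
- by apply: continuous_subspaceT => u; exact: continuous_horner.
- split.
  + by move=> u _; exact: derivable_horner.
  + by apply: cvg_at_right_filter; exact: continuous_horner.
  + by apply: cvg_at_left_filter; exact: continuous_horner.
- by move=> u _; rewrite derivE.
Qed.

Lemma horner_binomial_tail1 (R : realType) (n m : nat) : (m <= n)%N ->
  (binomial_tail R n m).[1] = 1.
Proof.
move=> mn; rewrite horner_binomial_tail (bigD1 ord_max)//= big1 ?addr0.
  by rewrite subnn expr0 mulr1 binn expr1n.
move=> i /andP[_]; rewrite -val_eqE/= => ni.
rewrite subrr expr0n subn_eq0 leqNgt ltn_neqAle ni -ltnS ltn_ord/=.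
by rewrite mulr0 mul0rn.
Qed.

Lemma inc_beta_binomial_tail (R : realType) (m j : nat) (p : R) : 0 <= p <= 1 ->
  ((m + j).+1 * 'C(m + j, m))%:R * inc_beta p m.+1%:R j.+1%:R =
  (binomial_tail R (m + j).+1 m.+1).[p].
Proof.
move=> p01; have /andP[p0 p1] := p01.
rewrite inc_betaE// -RintegralZl//; last exact: integrable_beta.
by rewrite /Rintegral integral_binomial_tail.
Qed.

(** * Expectation of a time whose survival function is a binomial tail *)

Section expectation_count.
Context (R : realType) (d : measure_display) (Omega : measurableType d)
  (P : probability Omega R).
Context (m j : nat).
Let n := (m + j).+1.
Context (T : Omega -> R) (b : R -> 'I_n -> Omega -> bool) (p g : R -> R).
Hypothesis mT : measurable_fun setT T.
Hypothesis mb : forall t i, measurable [set w | b t i w].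
Hypothesis Pb : forall t (J : {set 'I_n}),
  P [set w | [forall i in J, b t i w]] = (p t ^+ #|J|)%:E.
Hypothesis PT : forall t,
  P [set w | t < T w] = P [set w | (m < #|[pred i | b t i w]|)%N].
Hypothesis p0 : p 0 = 1.
Hypothesis mg : measurable_fun setT g.
Hypothesis g0 : forall u, 0 < u < 1 -> 0 <= g u.
Hypothesis pg : forall t u, 0 <= t -> 0 < u < 1 -> (u < p t) = (t < g u).

Let p01 t : 0 <= p t <= 1.
Proof.
have := Pb t [set ord0]%SET; rewrite cards1 expr1 => pE.
apply/andP; split; rewrite -lee_fin -pE; first exact: measure_ge0.
apply: probability_le1.
rewrite [X in measurable X](_ : _ = [set w | b t ord0 w])//.
apply/seteqP; split=> w /=; first by move=> /forall_inP; apply; rewrite inE.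
by move=> bw; apply/forall_inP => i; rewrite inE => /eqP ->.
Qed.

(** The tail formula for expectations wants a variable that is nonnegative everywhere, and [T] may
    be negative on a null set. Since [p 0 = 1], the event [0 < T] has probability one, so [T] can be
    replaced by its positive part. *)
Let ae_T_ge0 : {ae P, forall w, 0 <= T w}.
Proof.
have m0 : measurable [set w | 0 < T w] by exact: measurable_fun_gt.
exists (~` [set w | 0 < T w]); split; first exact: measurableC.
  by rewrite probability_setC// PT (probability_count (mb 0) (Pb 0)) p0
    horner_binomial_tail1 ?subee ?ltnS ?leq_addr.
by move=> w /= + /ltW.
Qed.

Let Tp w := Num.max (T w) 0.
Let mTp : measurable_fun setT Tp.
Proof. exact: measurable_maxr. Qed.

(* [g u] is the length of the set of times [t >= 0] with [u < p t], so Tonelli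
   turns the integral over [t] of the binomial tail at [p t] into this one. *)
Lemma expectation_count_integral : ('E_P[T] =
  \int[@lebesgue_measure R]_(u in `]0%R, 1%R[)
    (((m + j).+1 * 'C(m + j, m))%:R * beta_integrand m.+1%:R j u * g u)%:E)%E.
Proof.
pose h u := ((m + j).+1 * 'C(m + j, m))%:R * beta_integrand m.+1%:R j u : R.
have mh : measurable_fun setT h.
  by apply: measurable_funM => //; exact: measurable_beta_integrand.
have h0 u : 0 <= u <= 1 -> 0 <= h u.
  move=> /andP[u0 u1]; rewrite !mulr_ge0 ?powR_ge0// exprn_ge0// subr_ge0//.
transitivity ('E_P[Tp])%E.
  rewrite !unlock; apply: ae_eq_integral => //.
  - exact/measurable_EFinP.
  - exact/measurable_EFinP.
  - apply: filterS ae_T_ge0 => w Tw _ /=.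
    by rewrite /Tp max_l.
pose X : {RV P >-> R} := mfun_Sub (mem_set mTp).
have -> : ('E_P[Tp] = 'E_P[X])%E by [].
rewrite ge0_expectation_ccdf; last by move=> w; rewrite /= /Tp le_max lexx orbT.
(* By [pg], [g] is a generalized inverse of [p]: the section of this region at [u] in ]0, 1[ is [0,
   g u[, and the one at [t >= 0] is ]0, p t[. *)
pose Q := [set z : measurableTypeR R * measurableTypeR R |
  [&& 0 < z.1, z.1 < 1, 0 <= z.2 & z.2 < g z.1]].
have mQ : measurable Q.
  have mpred (q : measurableTypeR R * measurableTypeR R -> bool) :
      measurable_fun setT q -> measurable [set z | q z].
    by move=> mq; have := mq measurableT [set true] I; rewrite setTI.
  apply: mpred; repeat apply: measurable_and.
  - exact: measurable_fun_ltr.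
  - exact: measurable_fun_ltr.
  - exact: measurable_fun_ler.
  - by apply: measurable_fun_ltr => //; exact: measurableT_comp.
have xQ (u : R) : xsection Q u = if 0 < u < 1 then `[0, g u[%classic else set0.
  apply/seteqP; split=> t; rewrite /xsection/= inE/=.
    by case/and4P => -> -> t0 tg /=; rewrite in_itv/= t0.
  by rewrite /Q/=; case: ifPn => //= /andP[-> ->]; rewrite in_itv/=.
have yQ (t : R) : 0 <= t -> ysection Q t = `]0, p t[%classic.
  move=> t0; apply/seteqP; split=> u; rewrite /ysection/= inE/= in_itv/=.
    by case/and4P => u0 u1 _ tg /=; rewrite u0 pg// u0 u1.
  move=> /andP[u0 up]; have u1 : u < 1.
    by rewrite (lt_le_trans up)//; case/andP: (p01 t).
  by rewrite /Q/= u0 u1 t0/= -pg// u0 u1.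
have yQ0 (t : R) : t < 0 -> ysection Q t = set0.
  move=> t0; apply/seteqP; split=> u //; rewrite /ysection/= inE/=.
  by case/and4P => _ _; rewrite leNgt t0.
(* [tonelli_section] wants nonnegativity on the whole line, but [h] is negative beyond 1 when [j] is
   odd; on [0, 1] the absolute value changes nothing. *)
have mhn : measurable_fun setT (fun u => `|h u|) by exact: measurableT_comp.
have tonelli := tonelli_section mQ mhn (@measurable_cst _ _ _ _ _ (1 : R))
  (fun u => normr_ge0 _) (fun u => ler01).
transitivity (\int[@lebesgue_measure R]_t (1%:E *
    \int[@lebesgue_measure R]_(u in ysection Q t) `|h u|%:E))%E.
  rewrite [LHS]integral_mkcond; apply: eq_integral => t _.
  rewrite patchE mem_setE in_itv/= andbT mul1e.
  case: ifPn => t0; last by rewrite yQ0 ?integral_set0// ltNge.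
  have /andP[pt0 pt1] := p01 t.
  rewrite yQ// -(@integral_itv_bndoo _ _ _ _ true false)//; last first.
    by apply/measurable_EFinP; exact: measurable_funTS.
  transitivity (P [set w | t < T w]).
    rewrite /ccdf/= /pushforward; congr (P _); apply/seteqP; split=> w /=;
      rewrite in_itv/= andbT /Tp lt_max [t < 0]ltNge t0 orbF//.
  rewrite PT (probability_count (mb t) (Pb t)) -integral_binomial_tail//.
  apply: eq_integral => u; rewrite inE/= in_itv/= => /andP[u0 up].
  by rewrite ger0_norm ?h0// u0 (le_trans up).
rewrite -tonelli [RHS]integral_mkcond.
apply: eq_integral => u _; rewrite patchE xQ mem_setE in_itv/=.
case: ifPn => [/andP[u0 u1]|]; last by rewrite integral_set0 mule0.
rewrite integral_cst//= lebesgue_measure_itv/= lte_fin mul1e.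
rewrite ger0_norm ?h0 ?ltW//; have := @g0 u; rewrite u0 u1 => /(_ isT).
by rewrite le_eqVlt => /predU1P[<-|->]; rewrite ?ltxx ?mulr0 ?mule0// -EFinB subr0 -EFinM.
Qed.
End expectation_count.

(** * Integrals of quantile functions against the Beta density *)

Lemma beta_integrand_powR (R : realType) (y b : R) j (u : R) : 0 < u ->
  beta_integrand y j u * u `^ b = beta_integrand (y + b) j u.
Proof.
move=> u0; rewrite /beta_integrand mulrAC -powRD; last by rewrite (gt_eqF u0) implybT.
by rewrite addrAC.
Qed.

(** Extension by 0 from [r] on puts complete and incomplete integrals on one domain, where linearity
    applies. *)
Lemma integral_beta_trunc (R : realType) (y r : R) j : 0 < y -> 0 <= r <= 1 ->
  (@lebesgue_measure R).-integrable `[0, 1]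
    (EFin \o (fun u => if u < r then beta_integrand y j u else 0)) /\
  \int[@lebesgue_measure R]_(u in `[0, 1]) (if u < r then beta_integrand y j u else 0) =
  inc_beta r y j.+1%:R.
Proof.
move=> y0 r01; have /andP[r0 r1] := r01.
pose D : set (measurableTypeR R) := `[0, r[%classic.
have mD : measurable D by exact: measurable_itv.
have ib : (@lebesgue_measure R).-integrable D (EFin \o beta_integrand y j).
  apply: (@integrableS _ (measurableTypeR R) _ _ `[0, r]%classic) => //.
    by move=> x; rewrite /D/= !in_itv/= => /andP[-> /ltW].
  exact: integrable_beta.
have D01 : `[0, 1]%classic `&` D = D.
  by apply/setIidPr => x; rewrite /D/= !in_itv/= => /andP[-> /ltW /le_trans]; apply.
have fE u : u \in `[0, 1]%classic ->
    (if u < r then beta_integrand y j u else 0) = (beta_integrand y j \_ D) u.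
  rewrite inE/= in_itv/= => /andP[u0 _].
  by rewrite patchE /D mem_setE in_itv/= u0.
split.
  apply: (@eq_integrable _ (measurableTypeR R) _ _ _ _
    (EFin \o (beta_integrand y j \_ D))) => //.
    by move=> u u01 /=; rewrite fE.
  rewrite -restrict_EFin; apply/integrable_restrict => //.
  by rewrite D01.
rewrite inc_betaE// -[RHS]Rintegral_itv_bndo_bndc//.
transitivity (\int[@lebesgue_measure R]_(u in `[0, 1]) ((beta_integrand y j \_ D) u)).
  by apply: eq_Rintegral => u; exact: fE.
by rewrite -Rintegral_mkcondr D01.
Qed.

(** A factor u^(-1/a) only lowers the first Beta parameter by 1/a, and [1 < a] keeps it positive.
    The parameters [r], [D], [E] let one formula serve with relaunch and, when all are zero,
    without. *)
Lemma order_stat_integral (R : realType) (m j : nat) (s a r D E : R) (g : R -> R) :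
  1 < a -> 0 <= r <= 1 ->
  (forall u, 0 < u < 1 ->
     g u = s * u `^ (- a^-1) + (if u < r then D + E * (s * u `^ (- a^-1)) else 0)) ->
  let K : R := ((m + j).+1 * 'C(m + j, m))%:R in
  (\int[@lebesgue_measure R]_(u in `]0%R, 1%R[)
    (K * beta_integrand m.+1%:R j u * g u)%:E =
  (K * s * inc_beta 1 (m.+1%:R - a^-1) j.+1%:R
    + (D * (K * inc_beta r m.+1%:R j.+1%:R)
      + E * (K * s * inc_beta r (m.+1%:R - a^-1) j.+1%:R)))%:E)%E.
Proof.
move=> a1 r01 gE K; have a0 : 0 < a by apply: lt_trans a1.
pose y : R := m.+1%:R - a^-1.
have y0 : 0 < y by rewrite subr_gt0 (@lt_le_trans _ _ 1) ?invf_lt1// ler1n.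
have m0 : 0 < m.+1%:R :> R by [].
pose B z u : R := beta_integrand z j u.
pose C z u : R := if u < r then B z u else 0.
pose F u := K * s * B y u + (K * D * C m.+1%:R u + K * s * E * C y u).
have mB z : measurable_fun setT (B z) by exact: measurable_beta_integrand.
have mC z : measurable_fun setT (C z).
  by apply: measurable_fun_ifT => //; exact: measurable_fun_ltr.
have mF : measurable_fun setT F.
  by apply: measurable_funD; [|apply: measurable_funD]; exact: measurable_funM.
transitivity (\int[@lebesgue_measure R]_(u in `]0%R, 1%R[) (F u)%:E)%E.
  apply: eq_integral => u; rewrite inE/= in_itv/= => /andP[u0 u1]; congr EFin.
  rewrite gE ?u0//.
  have BE : B y u = beta_integrand m.+1%:R j u * u `^ (- a^-1).
    by rewrite beta_integrand_powR.
  by rewrite /F /C; case: ifPn => _; rewrite ?BE /B; ring.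
rewrite -(@integral_itv_bndoo _ _ _ _ true false); last first.
  by apply/measurable_EFinP; exact: measurable_funTS.
have [iC1 C1] := integral_beta_trunc j m0 r01.
have [iC2 C2] := integral_beta_trunc j y0 r01.
have iB : (@lebesgue_measure R).-integrable `[0, 1] (EFin \o B y).
  by apply: integrable_beta => //; rewrite ler01 lexx.
have iZ (c : R) (f : R -> R) : (@lebesgue_measure R).-integrable `[0, 1] (EFin \o f) ->
    (@lebesgue_measure R).-integrable `[0, 1] (EFin \o (fun u => c * f u)).
  move=> If; apply: (@eq_integrable _ (measurableTypeR R) _ _ _ _
    (fun u => c%:E * (EFin \o f) u)%E) => //.
  exact: integrableZl.
have iD (f f' : R -> R) : (@lebesgue_measure R).-integrable `[0, 1] (EFin \o f) ->
    (@lebesgue_measure R).-integrable `[0, 1] (EFin \o f') ->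
    (@lebesgue_measure R).-integrable `[0, 1] (EFin \o (fun u => f u + f' u)).
  move=> If If'; apply: (@eq_integrable _ (measurableTypeR R) _ _ _ _
    ((EFin \o f) \+ (EFin \o f'))%E) => //.
  exact: integrableD.
rewrite -[LHS]fineK; last first.
  apply: integrable_fin_num => //; apply: (iD); first exact: iZ.
  by apply: (iD); exact: iZ.
congr EFin.
change (\int[@lebesgue_measure R]_(u in `[0, 1]) F u =
  K * s * inc_beta 1 y j.+1%:R +
 (D * (K * inc_beta r m.+1%:R j.+1%:R) + E * (K * s * inc_beta r y j.+1%:R))).
rewrite RintegralD//; [|exact: iZ|by apply: (iD); exact: iZ].
rewrite RintegralD//; [|exact: iZ..].
rewrite !RintegralZl// C1 C2 [inc_beta 1 y _]inc_betaE// -/(B y).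
by ring.
Qed.

(** * Pareto survival functions and joint exceedances *)

Definition pareto_ccdf (R : realType) (s a t : R) : R :=
  if s <= t then (s / t) `^ a else 1.

(** s u^(-1/a) is the quantile function. For [t < s] both sides hold, since u < 1 and the quantile
    is at least [s]; otherwise x^a is increasing. *)
Lemma pareto_ccdf_gtE (R : realType) (s a t u : R) : 0 < s -> 0 < a -> 0 < u < 1 ->
  (u < pareto_ccdf s a t) = (t < s * u `^ (- a^-1)).
Proof.
move=> s0 a0 /andP[u0 u1]; rewrite /pareto_ccdf.
have ua : u `^ a^-1 <= 1.
  by rewrite -[leRHS](powRr0 u) ger_powR ?u0 ?invr_ge0 ?ltW.
have ua0 : 0 < u `^ a^-1 by exact: powR_gt0.
rewrite powRN; case: (leP s t) => [st|ts]; last first.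
  rewrite u1; apply/esym/(lt_le_trans ts).
  by rewrite ler_pMr// invr_ge1// unitf_gt0.
have t0 : 0 < t by exact: lt_le_trans st.
have uE : u = (u `^ a^-1) `^ a by rewrite -powRrM mulVf ?gt_eqF// powRr1// ltW.
have -> : (t < s * (u `^ a^-1)^-1) = (u `^ a^-1 < s / t).
  by rewrite ltr_pdivlMr// mulrC -ltr_pdivlMr.
rewrite [X in X < _]uE.
have [vs|sv] := ltP (u `^ a^-1) (s / t).
  by apply: gt0_ltr_powR; rewrite ?nnegrE ?divr_ge0 ?ltW.
by apply/negbTE; rewrite -leNgt ge0_ler_powR ?nnegrE ?divr_ge0
  ?(ltW a0) ?(ltW ua0) ?(ltW s0) ?(ltW t0).
Qed.

(** The minimum of [N] independent Pareto(s, alpha) times is Pareto(s, N alpha). *)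
Lemma pareto_ccdf_exp (R : realType) (s a t : R) (N : nat) :
  pareto_ccdf s a t ^+ N = pareto_ccdf s (N%:R * a) t.
Proof.
rewrite /pareto_ccdf; case: ifP => _; last by rewrite expr1n.
by rewrite [N%:R * a]mulrC powRrM powR_mulrn ?powR_ge0.
Qed.

Lemma eq_probability (R : realType) (d : measure_display) (Omega : measurableType d)
    (P : probability Omega R) (A B F : set Omega) :
  measurable A -> measurable B -> measurable F -> P F = 1%E ->
  A `&` F = B `&` F -> P A = P B.
Proof.
move=> mA mB mF F1 AB.
suff E C : measurable C -> P C = P (C `&` F) by rewrite E// AB -E.
move=> mC; rewrite (measureDI P mC mF).
rewrite (@subset_measure0 _ _ _ _ (C `\` F) (~` F)) ?add0e//.
- exact: measurableD.
- exact: measurableC.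
- by apply: (etrans (probability_setC _ mF)); rewrite F1 subee.
Qed.

Section pareto_groups.
Context (R : realType) (d : measure_display) (Omega : measurableType d)
  (P : probability Omega R).
Context (s alpha : R) (I : finType) (X X' : I -> {RV P >-> R}).
Hypothesis s0 : 0 < s.
Hypothesis iid : iid_pareto s alpha (initial_and_fresh X X').
Local Notation S := (pareto_ccdf s alpha).

Lemma measurable_RV_gt (Y : {RV P >-> R}) t : measurable [set w | t < Y w].
Proof. exact: measurable_fun_gt. Qed.

(* The two thresholds [c], [c'] allow one event to record both that the initial
   copy is relaunched and that its fresh copy is late. *)
Lemma probability_exceed (J : {set I}) (c c' : R) :
  P [set w | [forall z in J, (c < X z w) && (c' < X' z w)]] =
  ((S c * S c') ^+ #|J|)%:E.
Proof.
have [indep par] := iid.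
pose A (z : I + I) : set R := if z is inl _ then `]c, +oo[%classic else `]c', +oo[%classic.
pose JJ := [set z : I + I | match z with inl i => i \in J | inr i => i \in J end]%SET.
have mA z : measurable (A z) by case: z => i; exact: measurable_itv.
have := indep JJ A mA.
have -> : \bigcap_(i in [set` JJ]) (initial_and_fresh X X' i @^-1` A i) =
   [set w | [forall z in J, (c < X z w) && (c' < X' z w)]].
  apply/seteqP; split=> w /= h.
    apply/forall_inP => z zJ; apply/andP; split.
      by have := h (inl z); rewrite /JJ/= inE zJ => /(_ isT)/=; rewrite in_itv/= andbT.
    by have := h (inr z); rewrite /JJ/= inE zJ => /(_ isT)/=; rewrite in_itv/= andbT.
  by move=> [z|z] /=; rewrite inE => zJ; move/forall_inP : h => /(_ z zJ)/andP[h h'];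
    rewrite in_itv/= andbT.
move=> ->.
have PA z : P (initial_and_fresh X X' z @^-1` A z) =
    (if z is inl _ then S c else S c')%:E.
  by case: z => i; [exact: (par (inl i) c)|exact: (par (inr i) c')].
under eq_bigr do rewrite PA.
rewrite prodEFin big_sumType/=; congr EFin.
under eq_bigl do rewrite inE.
under [X in _ * X]eq_bigl do rewrite inE.
by rewrite !prodr_const exprMn.
Qed.

End pareto_groups.

(** * Tasks as groups of copies: expectations with and without relaunch *)

Section task_groups.
Context (R : realType) (d : measure_display) (Omega : measurableType d)
  (P : probability Omega R).
Context (s alpha : R) (I : finType) (X X' : I -> {RV P >-> R}).
Hypothesis s0 : 0 < s.
Hypothesis alpha1 : 1 < alpha.
Hypothesis iid : iid_pareto s alpha (initial_and_fresh X X').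
Context (m j N : nat) (task : I -> 'I_(m + j).+1).
Hypothesis N0 : (0 < N)%N.
Hypothesis card_task : forall i, #|[set z | task z == i]%SET| = N.
Let a : R := N%:R * alpha.
Let K : R := ((m + j).+1 * 'C(m + j, m))%:R.

(** [task] will be the identity for coding and the first projection for replication. Asking all
    copies to exceed a threshold is asking it of their minimum. *)
Definition group_exceeds (c c' : R) (i : 'I_(m + j).+1) (w : Omega) : bool :=
  [forall z, (task z == i) ==> (c < X z w) && (c' < X' z w)].

Lemma measurable_exceed (J : {set I}) (c c' : R) :
  measurable [set w | [forall z in J, (c < X z w) && (c' < X' z w)]].
Proof.
have -> : [set w | [forall z in J, (c < X z w) && (c' < X' z w)]] =
    \bigcap_(z in [set` J]) ([set w | c < X z w] `&` [set w | c' < X' z w]).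
  apply/seteqP; split=> [w /= /forall_inP h z /= /h/andP//|w /= h].
  by apply/forall_inP => z zJ; apply/andP; exact: h.
apply: fin_bigcap_measurable; first exact: finite_finset.
by move=> z _; apply: measurableI; exact: measurable_RV_gt.
Qed.

Lemma forall_group_exceeds (J : {set 'I_(m + j).+1}) c c' w :
  [forall i in J, group_exceeds c c' i w] =
  [forall z in task @^-1: J, (c < X z w) && (c' < X' z w)].
Proof.
apply/forall_inP/forall_inP => h.
  by move=> z; rewrite inE => /h /forallP /(_ z); rewrite eqxx.
by move=> i iJ; apply/forallP => z; apply/implyP => /eqP zi; apply: h; rewrite inE zi.
Qed.

Lemma card_task_preim (J : {set 'I_(m + j).+1}) : #|task @^-1: J| = (N * #|J|)%N.
Proof.
rewrite -sum1_card (partition_big task (mem J))/=; last by move=> z; rewrite inE.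
rewrite mulnC -sum_nat_const; apply: eq_bigr => i iJ.
rewrite -(card_task i) -sum1_card; apply: eq_bigl => z.
by rewrite !inE; case: eqP => [->|]; rewrite ?iJ ?andbF.
Qed.

Lemma probability_group_exceeds (J : {set 'I_(m + j).+1}) c c' :
  P [set w | [forall i in J, group_exceeds c c' i w]] =
  ((pareto_ccdf s a c * pareto_ccdf s a c') ^+ #|J|)%:E.
Proof.
under eq_set do rewrite forall_group_exceeds.
by rewrite (probability_exceed iid) card_task_preim exprM exprMn !pareto_ccdf_exp.
Qed.

Lemma measurable_group_exceeds c c' i : measurable [set w | group_exceeds c c' i w].
Proof.
rewrite [X in measurable X](_ : _ =
    [set w | [forall z in task @^-1: [set i]%SET, (c < X z w) && (c' < X' z w)]]).
  exact: measurable_exceed.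
apply/seteqP; split=> w /=; rewrite -forall_group_exceeds.
  by move=> h; apply/forall_inP => i'; rewrite inE => /eqP ->.
by move=> /forall_inP; apply; rewrite inE.
Qed.

Lemma expectation_groups (T : Omega -> R) (c c' g : R -> R) :
  measurable_fun setT T ->
  (forall t w, (forall z, 0 < X' z w) ->
    (t < T w) = (m < #|[pred i | group_exceeds (c t) (c' t) i w]|)%N) ->
  pareto_ccdf s a (c 0) * pareto_ccdf s a (c' 0) = 1 ->
  measurable_fun setT g -> (forall u, 0 < u < 1 -> 0 <= g u) ->
  (forall t u, 0 <= t -> 0 < u < 1 ->
    (u < pareto_ccdf s a (c t) * pareto_ccdf s a (c' t)) = (t < g u)) ->
  ('E_P[T] = \int[@lebesgue_measure R]_(u in `]0%R, 1%R[)
    (K * beta_integrand m.+1%:R j u * g u)%:E)%E.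
Proof.
move=> mT TE c0 mg g0 pg.
apply: (expectation_count_integral (b := fun t => group_exceeds (c t) (c' t))
  _ _ _ _ c0 mg g0 pg) => //.
- by move=> t i; exact: measurable_group_exceeds.
- by move=> t J; exact: probability_group_exceeds.
(* The description of [T] by counts is given only where all fresh times are positive. This event has
   probability one because the survival function is 1 at 0. *)
move=> t; apply: (@eq_probability _ _ _ _ _ _
    [set w | [forall z in [set: I]%SET, (0 < X z w) && (0 < X' z w)]]).
- exact: measurable_fun_gt.
- exact: (@measurable_count _ _ _ _ (leq m.+1)
    (fun i => measurable_group_exceeds (c t) (c' t) i)).
- exact: measurable_exceed.
- by rewrite (probability_exceed iid) /pareto_ccdf leNgt s0/= mulr1 expr1n.
have hX' w : [forall z in [set: I]%SET, (0 < X z w) && (0 < X' z w)] ->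
    forall z, 0 < X' z w.
  by move=> /forall_inP h z; have /andP[] := h z (finset.in_setT z).
by apply/seteqP; split=> w /= [+ h]; rewrite (TE _ _ (hX' _ h)).
Qed.

Let a1 : 1 < a.
Proof.
by rewrite (lt_le_trans alpha1)// ler_peMl ?ler1n// ltW// (lt_trans _ alpha1).
Qed.

Let a0 : 0 < a.
Proof. exact: lt_trans a1. Qed.

Let measurable_quantile : measurable_fun setT (fun u : R => s * u `^ (- a^-1)).
Proof. by apply: measurable_funM => //; exact: measurable_powR. Qed.

(** The fresh threshold 0 is exceeded almost surely, which makes the model without relaunch an
    instance of the two-threshold one. *)
Lemma expectation_norelaunch (T : Omega -> R) :
  measurable_fun setT T ->
  (forall t w, (forall z, 0 < X' z w) ->
    (t < T w) = (m < #|[pred i | group_exceeds t 0 i w]|)%N) ->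
  ('E_P[T] = (K * s * inc_beta 1 (m.+1%:R - a^-1) j.+1%:R)%:E)%E.
Proof.
move=> mT TE.
rewrite (expectation_groups (c := id) (c' := fun=> 0)
  (g := fun u => s * u `^ (- a^-1)) mT TE)//.
- rewrite (@order_stat_integral _ m j s a 0 0 0 _ a1)//.
  + by rewrite !mul0r !addr0.
  + by rewrite lexx ler01.
  + by move=> u /andP[u0 _]; rewrite ltNge (ltW u0)/= addr0.
- by rewrite /pareto_ccdf leNgt s0 mulr1.
- by move=> u /andP[u0 _]; rewrite mulr_ge0 ?powR_ge0// ltW.
- move=> t u _ u01; rewrite {2}/pareto_ccdf [s <= 0]leNgt s0 mulr1.
  exact: pareto_ccdf_gtE.
Qed.

Section relaunch.
Variable Delta : R.
Hypothesis Delta0 : 0 <= Delta.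
(* [rho `^ a] is the probability that a task is relaunched. *)
Let rho : R := if Delta <= s then 1 else s / Delta.
Let r : R := rho `^ a.

Lemma expectation_relaunch (T : Omega -> R) :
  measurable_fun setT T ->
  (forall t w, (forall z, 0 < X' z w) ->
    (t < T w) = (m < #|[pred i |
      group_exceeds (if (t < Delta)%R then t else Delta)
                    (if (t < Delta)%R then 0%R else (t - Delta)%R) i w]|)%N) ->
  ('E_P[T] = (K * s * inc_beta 1 (m.+1%:R - a^-1) j.+1%:R
    + (Delta * (K * inc_beta r m.+1%:R j.+1%:R)
      + (rho - 1) * (K * s * inc_beta r (m.+1%:R - a^-1) j.+1%:R)))%:E)%E.
Proof.
move=> mT TE.
have rho0 : 0 < rho.
  by rewrite /rho; case: (leP Delta s) => // sD; rewrite divr_gt0// (lt_trans s0).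
have rho1 : rho <= 1.
  rewrite /rho; case: (leP Delta s) => // sD.
  by rewrite ler_pdivrMr ?mul1r ?ltW// (lt_trans s0).
have r0 : 0 < r by exact: powR_gt0.
have r1 : r <= 1 by rewrite -[leRHS](powRr0 rho) ger_powR ?rho0// ltW.
have SD : pareto_ccdf s a Delta = r.
  rewrite /r /rho /pareto_ccdf; case: (ltgtP s Delta) => [//|_|<-]; first by rewrite powR1.
  by rewrite divff ?gt_eqF.
have S1 t : t < s -> pareto_ccdf s a t = 1 by move=> ts; rewrite /pareto_ccdf leNgt ts.
pose q u := s * u `^ (- a^-1).
have q0 u : 0 <= q u by rewrite mulr_ge0 ?powR_ge0// ltW.
(* After [Delta], u < r S(t - Delta) means t - Delta < q (u / r). Dividing by r = rho^a multiplies
   the quantile by [rho], whence the slope [rho] of [g] below [r]. *)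
have qr u : 0 < u -> q (u / r) = rho * q u.
  move=> u0; rewrite /q powRM ?invr_ge0 ?(ltW u0) ?(ltW r0)//.
  have -> : r^-1 `^ (- a^-1) = rho.
    rewrite -powR_inv1 ?(ltW r0)// /r -!powRrM [X in _ `^ X](_ : _ = 1) ?powRr1 ?(ltW rho0)//.
    by field; rewrite gt_eqF.
  by ring.
pose g u := q u + (if u < r then Delta + (rho - 1) * q u else 0).
have gE u : u < r -> g u = Delta + rho * q u by move=> ur; rewrite /g ur; ring.
have gE' u : r <= u -> g u = q u by move=> ur; rewrite /g ltNge ur/= addr0.
rewrite (expectation_groups (c := fun t => if t < Delta then t else Delta)
  (c' := fun t => if t < Delta then 0 else t - Delta) (g := g) mT TE)//.
- by apply: order_stat_integral => //; rewrite (ltW r0).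
(* For [Delta = 0], time 0 falls into the second branch, with both thresholds equal to 0. *)
- have [D0|D0] := ltP 0 Delta; first by rewrite S1// mulr1.
  have -> : Delta = 0 by apply/eqP; rewrite eq_le D0.
  by rewrite subr0 !S1// mulr1.
- apply: measurable_funD => //; apply: measurable_fun_ifT => //.
    exact: measurable_fun_ltr.
  by apply: measurable_funD => //; exact: measurable_funM.
- move=> u _; have [ur|ur] := ltP u r; last by rewrite gE'.
  by rewrite gE// addr_ge0// mulr_ge0// ltW.
move=> t u t0 u01; have /andP[u0 u1] := u01.
have qD : (u < r) = (Delta < q u) by rewrite -SD pareto_ccdf_gtE.
(* Before [Delta] only initial times matter. If [u < r], both quantiles lie beyond [t]: q u > Delta
   and g u >= Delta. *)
have [tD|Dt] := ltP t Delta.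
  rewrite (S1 0 s0) mulr1 pareto_ccdf_gtE// -/(q u).
  have [ur|ur] := ltP u r; last by rewrite gE'.
  rewrite gE//; move: ur; rewrite qD => /(lt_trans tD) ->.
  by rewrite (lt_le_trans tD)// lerDl mulr_ge0// ltW.
rewrite SD; have [ur|ur] := ltP u r.
  have ur01 : 0 < u / r < 1 by rewrite divr_gt0//= ltr_pdivrMr// mul1r.
  rewrite gE// mulrC -ltr_pdivrMr// pareto_ccdf_gtE// -/(q _) qr//.
  by rewrite ltrBlDl.
(* From [Delta] on, with [r <= u], both sides fail: the survival probability is at most [r], and q u
   <= Delta <= t. *)
rewrite gE' //; transitivity false.
  apply/negbTE; rewrite -leNgt (le_trans _ ur)// ler_piMr ?(ltW r0)//.
  rewrite /pareto_ccdf; case: ifP => // st; rewrite -[leRHS](powRr0 (s / (t - Delta))).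
  have td0 : 0 < t - Delta by exact: lt_le_trans st.
  by rewrite ger_powR ?divr_gt0 ?ler_pdivrMr ?mul1r ?(ltW a0).
apply/esym/negbTE; rewrite -leNgt (le_trans _ Dt)// leNgt -qD -leNgt//.
Qed.
End relaunch.
End task_groups.

(** * Order statistics, minima and maxima compared with a threshold *)

Lemma kth_smallest_gt (R : realType) (k : nat) (s : seq R) (t : R) :
  (0 < k <= size s)%N ->
  (t < kth_smallest k s) = (count (fun x => x <= t)%R s < k)%N.
Proof.
move=> /andP[k0 ks]; rewrite /kth_smallest.
have sorted_s : sorted <=%R (sort <=%R s) by exact: sort_le_sorted.
have cE : count (<= t) (sort <=%R s) = count (fun x => x <= t) s.
  by apply/permP; rewrite perm_sort.
rewrite -cE; apply/idP/idP => [|ck].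
  by apply: contraTT; rewrite -leqNgt -leNgt => kc; apply: nth_count_le; rewrite ?prednK.
apply: nth_count_gt => //; rewrite size_sort prednK// ks andbT.
by rewrite -ltnS prednK.
Qed.

Lemma count_image (T : Type) (I : finType) (A : pred I) (x : I -> T) (q : pred T) :
  count q [seq x i | i in A] = #|[pred i in A | q (x i)]|.
Proof.
rewrite count_map -size_filter cardE /enum_mem -filter_predI; congr size.
by apply: eq_filter => i; rewrite /= andbC.
Qed.

Lemma fastest_copy_gt (R : realType) c (x : 'I_c.+1 -> R) t :
  (t < fastest_copy x) = [forall j, t < x j].
Proof.
rewrite /fastest_copy; apply/idP/forallP => [h j|h].
  by apply: lt_le_trans h _; exact: bigmin_le_cond.
by apply/bigmin_gtP; split => [|j _]; exact: h.
Qed.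

Lemma slowest_task_gt (R : realType) k (hk : (0 < k)%N) (y : 'I_k -> R) t :
  (t < slowest_task hk y) = [exists i, t < y i].
Proof.
rewrite /slowest_task; apply/idP/existsP => [|[i yi]].
  move/bigmax_gtP => [h|[i _ h]]; first by exists (Ordinal hk).
  by exists i.
by apply: lt_le_trans yi _; exact: le_bigmax_cond.
Qed.

Lemma coding_time_gt (R : realType) n k (x : 'I_n -> R) t : (0 < k <= n)%N ->
  (t < coding_time k x) = (#|[pred i | (x i <= t)%R]| < k)%N.
Proof.
move=> kn; rewrite /coding_time kth_smallest_gt; last first.
  by rewrite size_map -cardE card_ord.
by rewrite count_image; congr (_ < _)%N; apply: eq_card => i; rewrite !inE.
Qed.

Lemma card_gt_le (R : realType) n (x : 'I_n -> R) t :
  (#|[pred i | (x i <= t)%R]| + #|[pred i | (t < x i)%R]| = n)%N.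
Proof.
rewrite -[RHS]card_ord -(cardC [pred i | (x i <= t)%R]); congr addn.
by apply: eq_card => i; rewrite !inE ltNge.
Qed.

(** In the second branch, the tasks finished by [Delta] and the relaunched ones whose fresh time is
    at most t - Delta are disjoint. Moving the number of the former across the inequality therefore
    counts their union, in which the condition of being relaunched disappears. *)
Lemma coding_relaunch_time_gt (R : realType) n k (Delta : R) (x x' : 'I_n -> R) t :
  (0 < k <= n)%N ->
  (t < coding_relaunch_time k Delta x x') =
  if (k <= #|[pred i | (x i <= Delta)%R]|)%N
  then (#|[pred i | (x i <= t)%R]| < k)%N
  else (#|[pred i | (x i <= Delta)%R || (x' i <= t - Delta)%R]| < k)%N.
Proof.
move=> /andP[k0 kn]; rewrite /coding_relaunch_time.
case: (leqP k #|[pred i | (x i <= Delta)%R]|) => [kr|rk].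
  by rewrite -coding_time_gt ?k0.
(* The rank is positive and at most the number of fresh times, so the default of [nth] is never
   read. *)
rewrite -ltrBlDl kth_smallest_gt; last first.
  rewrite subn_gt0 rk size_map -cardE leq_subLR.
  by rewrite (card_gt_le x Delta).
rewrite count_image ltn_subRL; congr (_ < _)%N.
rewrite -cardUI addnC.
rewrite (_ : #|[predI _ & _]| = 0%N) ?add0n; last first.
  by apply: eq_card0 => i; rewrite !inE; case: ltP => _; rewrite ?andbF.
by apply: eq_card => i; rewrite !inE; case: ltP.
Qed.

(** * From incomplete Beta integrals to the stated closed forms *)

Section closed_forms.
Context (R : realType) (m j : nat) (s a : R).
Hypothesis a1 : 1 < a.
Let K : R := ((m + j).+1 * 'C(m + j, m))%:R.
Let ET : R := K * s * inc_beta 1 (m.+1%:R - a^-1) j.+1%:R.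

Let y0 : 0 < m.+1%:R - a^-1.
Proof.
by rewrite subr_gt0 (@lt_le_trans _ _ 1) ?ler1n// invf_lt1// (lt_trans _ a1).
Qed.

Lemma inc_beta1_GammaE : ET =
  s * ((m + j).+1`!%:R / m`!%:R) *
  (Gamma (m.+1%:R - a^-1) / Gamma (m.+1%:R + j.+1%:R - a^-1)).
Proof.
rewrite /ET inc_beta1_Gamma// [_ - a^-1 + _]addrAC.
have -> : (m + j).+1`!%:R / m`!%:R = K * j`!%:R.
  have mf : m`!%:R != 0 :> R by rewrite pnatr_eq0 -lt0n fact_gt0.
  apply: (mulIf mf); rewrite divfK// /K -!natrM; congr _%:R.
  by rewrite factS -(bin_fact (leq_addr j m)) addKn -!mulnA [(m`! * _)%N]mulnC.
by ring.
Qed.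

Let inc_beta1_neq0 (y : R) : 0 < y -> inc_beta 1 y j.+1%:R != 0.
Proof.
move=> y_gt0; rewrite inc_beta1// mulf_neq0 ?invr_neq0 ?pnatr_eq0 -?lt0n ?fact_gt0//.
by rewrite gt_eqF// prodr_gt0// => i _; rewrite ltr_wpDr.
Qed.

(** [K] is the reciprocal of the complete Beta integral, because the binomial tail equals 1 at 1. *)
Lemma inc_beta_regE (r : R) :
  K * inc_beta r m.+1%:R j.+1%:R = reg_inc_beta r m.+1%:R j.+1%:R.
Proof.
have K1 : K * inc_beta 1 m.+1%:R j.+1%:R = 1.
  rewrite inc_beta_binomial_tail ?ler01 ?lexx// horner_binomial_tail1//.
  by rewrite ltnS leq_addr.
have i0 : inc_beta 1 m.+1%:R j.+1%:R != 0 :> R by exact: inc_beta1_neq0.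
by rewrite /reg_inc_beta -[K](mulfK i0) K1 mul1r mulrC.
Qed.

(** For [Delta <= s], rho = 1 makes the first incomplete integral complete and kills the second; for
    [s < Delta], rho^a is 1 - q. *)
Lemma relaunch_value (Delta : R) :
  let rho : R := if Delta <= s then 1 else s / Delta in
  let q : R := (s < Delta)%R%:R * (1 - (s / Delta) `^ a) in
  ET + (Delta * (K * inc_beta (rho `^ a) m.+1%:R j.+1%:R)
      + (rho - 1) * (K * s * inc_beta (rho `^ a) (m.+1%:R - a^-1) j.+1%:R)) =
  if Delta <= s then Delta + ET
  else Delta * reg_inc_beta (1 - q) m.+1%:R j.+1%:R
       + ET * (1 + (s / Delta - 1) * reg_inc_beta (1 - q) (m.+1%:R - a^-1) j.+1%:R).
Proof.
move=> rho q; rewrite inc_beta_regE /q /rho.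
have [Ds|sD] := leP Delta s.
  rewrite powR1 subrr mul0r addr0 /reg_inc_beta divff ?inc_beta1_neq0//.
  by rewrite mulr1 addrC.
rewrite mul1r subKr /reg_inc_beta /ET; have := inc_beta1_neq0 y0.
move: (inc_beta 1 (m.+1%:R - a^-1) _) (inc_beta ((s / Delta) `^ a) (m.+1%:R - a^-1) _)
  (inc_beta _ m.+1%:R _ / _) => B1 Br I B1_neq0.
by move: (s / Delta) K => z K'; field.
Qed.

End closed_forms.

(** With first parameter 1 the tail means at least one success, the complement of no success. This
    produces the term 1 - q^k of replication. *)
Lemma reg_inc_beta_1nat (R : realType) (j : nat) (r : R) : 0 <= r <= 1 ->
  reg_inc_beta r 1 j.+1%:R = 1 - (1 - r) ^+ j.+1.
Proof.
move=> r01; rewrite -(inc_beta_regE 0) inc_beta_binomial_tail//.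
have := congr1 (fun p => p.[r]) (@binomial_tail_recl R j.+1 0 (leq0n _)).
rewrite bin0 mulr1n expr0 mul1r subn0 hornerD horner_exp hornerD hornerN hornerX hornerC.
suff -> : (binomial_tail R j.+1 0).[r] = 1.
  by move=> /(congr1 (fun z => z - (1 - r) ^+ j.+1)); rewrite addrAC subrr add0r => ->.
rewrite horner_binomial_tail -[RHS](expr1n _ j.+1) -[in RHS](subrK r 1) exprDn.
by apply: eq_bigr => i _; rewrite mulrC.
Qed.

Lemma measurable_RV_le (R : realType) (d : measure_display) (Omega : measurableType d)
    (P : probability Omega R) (Y : {RV P >-> R}) t : measurable [set w | Y w <= t].
Proof.
rewrite [X in measurable X](_ : _ = ~` [set w | t < Y w]).
  by apply: measurableC; exact: measurable_RV_gt.
by apply/seteqP; split=> w /=; rewrite leNgt; move/negP.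
Qed.

(** * Coding: measurability and reduction to counts *)

Section coding.
Context (R : realType) (d : measure_display) (Omega : measurableType d)
  (P : probability Omega R).
Context (m j : nat).
Let n := (m + j).+1.
Let k := j.+1.
Context (X X' : 'I_n -> {RV P >-> R}).

Let kn : (0 < k <= n)%N.
Proof. by rewrite /= ltnS leq_addl. Qed.

Let ltn_kE (A B : nat) : (A + B = n)%N -> (A < k)%N = (m < B)%N.
Proof. by move=> AB; rewrite -(ltn_add2r B) AB /n /k addSn ltnS (addnC m) ltn_add2l. Qed.

Lemma measurable_coding_time : measurable_fun setT (fun w => coding_time k (fun i => X i w)).
Proof.
apply: measurable_fun_ray => t; under eq_set do rewrite coding_time_gt//.
apply: (@measurable_count _ _ _ (fun i w => X i w <= t) (fun c => (c < k)%N)) => i.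
exact: measurable_RV_le.
Qed.

Lemma measurable_coding_relaunch_time Delta : measurable_fun setT
  (fun w => coding_relaunch_time k Delta (fun i => X i w) (fun i => X' i w)).
Proof.
apply: measurable_fun_ray => t; under eq_set do rewrite coding_relaunch_time_gt//.
pose B1 := [set w | (k <= #|[pred i | (X i w <= Delta)%R]|)%N].
pose B2 := [set w | (#|[pred i | (X i w <= t)%R]| < k)%N].
pose B3 := [set w | (#|[pred i | (X i w <= Delta)%R || (X' i w <= t - Delta)%R]| < k)%N].
rewrite [Y in measurable Y](_ : _ = (B1 `&` B2) `|` (~` B1 `&` B3)); last first.
  apply/seteqP; split=> w; rewrite /B1 /B2 /B3 /=.
    by case: ifPn => [kr h|/negP kr h]; [left|right].
  by case=> -[+ h]; [move=> ->|move=> /negP/negbTE ->].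
have mB1 : measurable B1.
  apply: (@measurable_count _ _ _ (fun i w => X i w <= Delta) (fun c => (k <= c)%N)) => i.
  exact: measurable_RV_le.
apply: measurableU; apply: measurableI => //.
- apply: (@measurable_count _ _ _ (fun i w => X i w <= t) (fun c => (c < k)%N)) => i.
  exact: measurable_RV_le.
- exact: measurableC.
- apply: (@measurable_count _ _ _
    (fun i w => (X i w <= Delta) || (X' i w <= t - Delta)) (fun c => (c < k)%N)) => i.
  rewrite [Y in measurable Y](_ : _ =
      [set w | X i w <= Delta] `|` [set w | X' i w <= t - Delta]).
    by apply: measurableU; exact: measurable_RV_le.
  by apply/seteqP; split=> w /=; [case/orP; [left|right]|case=> ->; rewrite ?orbT].
Qed.

Let group_exceeds_id c c' i w :
  group_exceeds X X' id c c' i w = (c < X i w) && (c' < X' i w).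
Proof.
by apply/forallP/idP => [/(_ i)|h z]; [rewrite eqxx|apply/implyP => /eqP ->].
Qed.

Lemma coding_time_group t w : (forall z, 0 < X' z w) ->
  (t < coding_time k (fun i => X i w)) =
  (m < #|[pred i | group_exceeds X X' id t 0 i w]|)%N.
Proof.
move=> X'0; rewrite coding_time_gt//; apply: ltn_kE.
rewrite -[RHS](card_gt_le (fun i => X i w) t); congr addn.
by apply: eq_card => i; rewrite !inE group_exceeds_id X'0 andbT.
Qed.

(** The right side treats every task late at [Delta] as relaunched. For [t < Delta] this agrees with
    the model because fresh times are positive; for [t >= Delta] a discrepancy could arise only when
    [k] tasks are finished by [Delta], and then both sides are false. *)
Lemma coding_relaunch_time_group Delta t w : (forall z, 0 < X' z w) ->
  (t < coding_relaunch_time k Delta (fun i => X i w) (fun i => X' i w)) =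
  (m < #|[pred i | group_exceeds X X' id (if (t < Delta)%R then t else Delta)
      (if (t < Delta)%R then 0%R else (t - Delta)%R) i w]|)%N.
Proof.
move=> X'0; rewrite coding_relaunch_time_gt//.
have le_card t1 t2 : t1 <= t2 ->
    (#|[pred i | (X i w <= t1)%R]| <= #|[pred i | (X i w <= t2)%R]|)%N.
  move=> t12; apply: subset_leq_card; apply/fintype.subsetP => i.
  by rewrite !inE => /le_trans; apply.
have [tD|Dt] := ltP t Delta.
  rewrite -coding_time_group// coding_time_gt//.
  case: (leqP k #|[pred i | (X i w <= Delta)%R]|) => // rk.
  rewrite (leq_ltn_trans (le_card _ _ (ltW tD)) rk).
  rewrite (eq_card (B := [pred i | (X i w <= Delta)%R]))// => i.
  by rewrite !inE [X' i w <= _]leNgt (lt_trans _ (X'0 i)) ?orbF// subr_lt0.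
have countE : (#|[pred i | (X i w <= Delta)%R || (X' i w <= t - Delta)%R]| +
    #|[pred i | group_exceeds X X' id Delta (t - Delta) i w]| = n)%N.
  rewrite -[RHS]card_ord -(cardC [pred i | (X i w <= Delta)%R || (X' i w <= t - Delta)%R]).
  congr addn; apply: eq_card => i.
  by rewrite !inE group_exceeds_id negb_or -!ltNge.
rewrite -(ltn_kE countE); case: (leqP k #|[pred i | (X i w <= Delta)%R]|) => // kr.
rewrite ltnNge (leq_trans kr (le_card _ _ Dt))/=; apply/esym/negbTE; rewrite -leqNgt.
apply: (leq_trans kr); apply: subset_leq_card; apply/fintype.subsetP => i.
by rewrite !inE => ->.
Qed.

End coding.

(** * Replication: measurability and reduction to counts *)

Section replication.
Context (R : realType) (d : measure_display) (Omega : measurableType d)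
  (P : probability Omega R).
Context (j c : nat) (hk : (0 < j.+1)%N).
Context (X X' : 'I_j.+1 * 'I_c.+1 -> {RV P >-> R}).

Lemma measurable_fastest_copy (Y : 'I_j.+1 * 'I_c.+1 -> {RV P >-> R}) i :
  measurable_fun setT (fun w => fastest_copy (fun l => Y (i, l) w)).
Proof.
apply: measurable_fun_ray => t; under eq_set do rewrite fastest_copy_gt.
rewrite [Z in measurable Z](_ : _ = \bigcap_(l in setT) [set w | t < Y (i, l) w]).
  by apply: fin_bigcap_measurable => // l _; exact: measurable_RV_gt.
by apply/seteqP; split=> [w /= /forallP h l _ /=|w h]; [exact: h|apply/forallP => l; exact: h].
Qed.

Lemma measurable_slowest_task (y : Omega -> 'I_j.+1 -> R) :
  (forall i, measurable_fun setT (y ^~ i)) ->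
  measurable_fun setT (fun w => slowest_task hk (y w)).
Proof.
move=> my; apply: measurable_fun_ray => t; under eq_set do rewrite slowest_task_gt.
rewrite [Z in measurable Z](_ : _ = \bigcup_(i in setT) [set w | t < y w i]).
  by apply: fin_bigcup_measurable => // i _; exact: measurable_fun_gt.
by apply/seteqP; split=> [w /= /existsP[i ti]|w [i _ ti]]; [exists i|apply/existsP; exists i].
Qed.

Lemma measurable_replication_time :
  measurable_fun setT (fun w => replication_time hk (fun ij => X ij w)).
Proof. by apply: measurable_slowest_task => i; exact: measurable_fastest_copy. Qed.

Lemma measurable_replication_relaunch_time Delta :
  measurable_fun setT (fun w => replication_relaunch_time hk Delta
    (fun ij => X ij w) (fun ij => X' ij w)).
Proof.
apply: measurable_slowest_task => i; apply: measurable_fun_ifT.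
- by apply: measurable_fun_ler => //; exact: measurable_fastest_copy.
- exact: measurable_fastest_copy.
- by apply: measurable_funD => //; exact: measurable_fastest_copy.
Qed.

(** The ordinal type is written [(0 + j).+1] to fit the generic setting at [m = 0]: a maximum is
    late as soon as one task is. *)
Let group_exceeds_fst t t' i w :
  group_exceeds X X' (fst : _ -> 'I_(0 + j).+1) t t' i w =
  (t < fastest_copy (fun l => X (i, l) w)) && (t' < fastest_copy (fun l => X' (i, l) w)).
Proof.
rewrite !fastest_copy_gt; apply/forallP/andP => [h|[/forallP h /forallP h'] [i' l]].
  by split; apply/forallP => l; have := h (i, l); rewrite eqxx => /andP[].
by apply/implyP => /eqP /= ->; rewrite h h'.
Qed.

Let card_group (b : pred 'I_j.+1) : [exists i, b i] = (0 < #|[pred i | b i]|)%N.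
Proof. by apply/existsP/card_gt0P => -[i]; exists i. Qed.

Lemma replication_time_group t w : (forall z, 0 < X' z w) ->
  (t < replication_time hk (fun ij => X ij w)) =
  (0 < #|[pred i | group_exceeds X X' (fst : _ -> 'I_(0 + j).+1) t 0 i w]|)%N.
Proof.
move=> X'0; rewrite slowest_task_gt card_group; congr (_ < _)%N.
apply: eq_card => i; rewrite !inE group_exceeds_fst.
rewrite (_ : 0 < fastest_copy _) ?andbT// fastest_copy_gt.
by apply/forallP => l; exact: X'0.
Qed.

Lemma replication_relaunch_time_group Delta t w : (forall z, 0 < X' z w) ->
  (t < replication_relaunch_time hk Delta (fun ij => X ij w) (fun ij => X' ij w)) =
  (0 < #|[pred i | group_exceeds X X' (fst : _ -> 'I_(0 + j).+1)
      (if (t < Delta)%R then t else Delta)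
      (if (t < Delta)%R then 0%R else (t - Delta)%R) i w]|)%N.
Proof.
move=> X'0; rewrite slowest_task_gt card_group; congr (_ < _)%N.
apply: eq_card => i; rewrite !inE group_exceeds_fst.
have : 0 < fastest_copy (fun l => X' (i, l) w).
  by rewrite fastest_copy_gt; apply/forallP => l; exact: X'0.
rewrite /=; move: (fastest_copy (fun l => X (i, l) w)) => W.
move: (fastest_copy (fun l => X' (i, l) w)) => W' W'0.
(* Positivity of [W'] matters when [t < Delta < W]: the relaunched task must still be late at
   [t]. *)
have [tD|Dt] := ltP t Delta; have [WD|DW] /= := leP W Delta.
- by rewrite W'0 andbT.
- by rewrite W'0 (lt_trans tD DW) (lt_trans tD)// ltrDl.
- by rewrite ltNge (le_trans WD Dt).
- by rewrite ltrBlDl.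
Qed.

End replication.

Theorem theorem10 (R : realType) (d : measure_display)
    (Omega : measurableType d) (P : probability Omega R)
    (k c n : nat) (s alpha Delta : R)
    (hk : (0 < k)%N) (hn : (k < n)%N)
    (hs : 0 < s) (halpha : 1 < alpha) (hDelta : 0 <= Delta) :
  (* Replication *)
  (forall X X' : 'I_k * 'I_c.+1 -> {RV P >-> R},
     iid_pareto s alpha (initial_and_fresh X X') ->
     let a : R := c.+1%:R * alpha in
     let q : R := (s < Delta)%R%:R * (1 - (s / Delta) `^ a) in
     let ETnorel : R :=
       s * k`!%:R * (Gamma (1 - 1 / a) / Gamma (k%:R + 1 - 1 / a)) in
     'E_P[fun w => replication_time hk (fun ij => X ij w)]%E = ETnorel%:E
     /\
     'E_P[fun w => replication_relaunch_time hk Delta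
                     (fun ij => X ij w) (fun ij => X' ij w)]%E =
       (if Delta <= s then Delta + ETnorel
        else Delta * (1 - q ^+ k)
             + ETnorel * (1 + (s / Delta - 1)
                              * reg_inc_beta (1 - q) (1 - 1 / a) k%:R))%:E)
  /\
  (* Coding *)
  (forall X X' : 'I_n -> {RV P >-> R},
     iid_pareto s alpha (initial_and_fresh X X') ->
     let q : R := (s < Delta)%R%:R * (1 - (s / Delta) `^ alpha) in
     let ETnorel : R :=
       s * (n`!%:R / (n - k)`!%:R)
         * (Gamma (n%:R - k%:R + 1 - 1 / alpha)
            / Gamma (n%:R + 1 - 1 / alpha)) in
     'E_P[fun w => coding_time k (fun i => X i w)]%E = ETnorel%:E
     /\
     'E_P[fun w => coding_relaunch_time k Delta
                     (fun i => X i w) (fun i => X' i w)]%E =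
       (if Delta <= s then Delta + ETnorel
        else Delta * reg_inc_beta (1 - q) (n%:R - k%:R + 1) k%:R
             + ETnorel * (1 + (s / Delta - 1)
                              * reg_inc_beta (1 - q)
                                  (n%:R - k%:R + 1 - 1 / alpha) k%:R))%:E).
Proof.
have [j jE] : exists j, k = j.+1 by exists k.-1; rewrite prednK.
subst k; split=> [X X' iid a q ETnorel|].
  have card_fst (i : 'I_(0 + j).+1) :
      #|[set z : 'I_j.+1 * 'I_c.+1 | (z.1 : 'I_(0 + j).+1) == i]%SET| = c.+1.
    rewrite -[RHS](card_ord c.+1) -[RHS]mul1n -(cards1 i) -cardsT -cardsX.
    by apply: eq_card => z; rewrite !inE andbT.
  have a1 : 1 < a.
    by rewrite (lt_le_trans halpha)// ler_peMl ?ler1n// ltW// (lt_trans _ halpha).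
  have ETE : ETnorel = ((0 + j).+1 * 'C(0 + j, 0))%:R * s *
      inc_beta 1 (1%:R - a^-1) j.+1%:R.
    rewrite (inc_beta1_GammaE 0 j s a1) fact0 divr1 /ETnorel add0n div1r.
    by rewrite (addrC 1 j.+1%:R).
  clearbody ETnorel; split.
    rewrite (expectation_norelaunch hs halpha iid (ltn0Sn c) card_fst
      (measurable_replication_time _ _) (@replication_time_group _ _ _ _ _ _ hk X X')).
    by rewrite ETE.
  rewrite (expectation_relaunch hs halpha iid (ltn0Sn c) card_fst hDelta
    (measurable_replication_relaunch_time _ _ _ _)
    (@replication_relaunch_time_group _ _ _ _ _ _ hk X X' Delta)).
  apply: (etrans (congr1 EFin (relaunch_value 0 j s a1 Delta))).
  rewrite -ETE -/q; case: (leP Delta s) => [//|sD].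
  have D0 : 0 < Delta by exact: lt_trans sD.
  have q01 : 0 <= 1 - q <= 1.
    rewrite /q sD mul1r subKr powR_ge0 -[leRHS](powRr0 (s / Delta)).
    by rewrite ger_powR ?divr_gt0 ?ler_pdivrMr ?mul1r ?ltW// (lt_trans _ a1).
  by rewrite (reg_inc_beta_1nat j q01) subKr div1r.
(* Here [m] is n - k, so the first Beta parameter [m + 1] is n - k + 1. *)
have [m nE] : exists m, n = (m + j).+1.
  by exists (n - j.+1)%N; rewrite -addnS subnK// ltnW.
subst n => X X' iid q ETnorel.
have card_id (i : 'I_(m + j).+1) : #|[set z | id z == i]%SET| = 1%N.
  by rewrite -(cards1 i); apply: eq_card => z; rewrite !inE.
have yE : (m + j).+1%:R - j.+1%:R + 1 = m.+1%:R :> R.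
  by rewrite -addnS natrD addrK natr1.
have ETE : ETnorel = ((m + j).+1 * 'C(m + j, m))%:R * s *
    inc_beta 1 (m.+1%:R - alpha^-1) j.+1%:R.
  rewrite (inc_beta1_GammaE m j s halpha) /ETnorel yE div1r subSS addnK.
  by rewrite -natrD addSn addnS natr1.
clearbody ETnorel; split.
  rewrite (expectation_norelaunch hs halpha iid (ltn0Sn 0) card_id
    (measurable_coding_time _) (@coding_time_group _ _ _ _ _ _ X X')).
  by rewrite [1%:R * alpha]mul1r -ETE.
rewrite (expectation_relaunch hs halpha iid (ltn0Sn 0) card_id hDelta
  (measurable_coding_relaunch_time _ _ _)
  (@coding_relaunch_time_group _ _ _ _ _ _ X X' Delta)).
by rewrite [1%:R * alpha]mul1r (relaunch_value m j s halpha Delta) -ETE yE div1r.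
Qed.
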